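(* Let $K$ be a two-dimensional local field, $V=K$, $H=K^*$ acting on $K$ by multiplication, and $L=\mathcal O_K$. Consider the central extension $0\to\mathbb Z\to G_{V,L}\to K^*\to 1$ described in the context. Then for all $f,g\in K^*$, $$\psi_V(f,g)=-\nu_K(f,g).$$
   Context: $k$ is a field, $K=k((t_1))((t_2))$, $\bar K=k((t_1))$, $\mathcal O_K=\bar K[[t_2]]$. For $b\in K^*$: $\nu_2(b)$ is the $t_2$-adic valuation, $\nu_1(b)$ is the $t_1$-adic valuation of the residue of $b t_2^{-\nu_2(b)}$ modulo $t_2\mathcal O_K$; $\nu_K(f,g)=\nu_1(f)\nu_2(g)-\nu_2(f)\nu_1(g)$. Dimension theories. Let $W$ be a $k$-vector space with an (exhaustive, separated) filtration by subspaces whose successive quotients are finite-dimensional over $k$. Subspaces $U_1,U_2$ are commensurable if $\dim_k U_i/(U_1\cap U_2)<\infty$ for $i=1,2$; then $[U_1|U_2]:=\dim_k U_2/(U_1\cap U_2)-\dim_k U_1/(U_1\cap U_2)$. $\mathrm{Gr}(W)$ is the set of subspaces commensurable with some member of the filtration. $\mathrm{Dim}(W)$ is the set of maps $d:\mathrm{Gr}(W)\to\mathbb Z$ with $d(U_2)=d(U_1)+[U_1|U_2]$ for all $U_1,U_2$; $\mathbb Z$ acts by adding constants, making $\mathrm{Dim}(W)$ a $\mathbb Z$-torsor. For an exact sequence $0\to W'\xrightarrow{\alpha}W\xrightarrow{\beta}W''\to0$ with induced and quotient filtrations, there is the identification $\mathrm{Dim}(W')\odot\mathrm{Dim}(W'')\cong\mathrm{Dim}(W)$,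 $(d',d'')\mapsto(U\mapsto d'(\alpha^{-1}U)+d''(\beta U))$ ($\odot$ = tensor product of $\mathbb Z$-torsors). Commensurability in $K$. An $\mathcal O_K$-lattice is a nonzero proper $\mathcal O_K$-submodule $L$ with $L\otimes_{\mathcal O_K}K=K$. For $k$-subspaces $A,B\subset K$, $A\approx B$ iff there are $\mathcal O_K$-lattices $L\subseteq M$ with $L\subseteq A\subseteq M$ and $L\subseteq B\subseteq M$. If $C\subseteq A$, $C\approx A$, then $A/C$ is a subquotient of the finite-dimensional $\bar K$-space $M/L$ and carries the filtration induced by the $k[[t_1]]$-lattices of $M/L$, with finite-dimensional factors. For $A\approx B$ define the $\mathbb Z$-torsor $$[[A|B]]=\varinjlim_{C\subseteq A\cap B,\ C\approx A}\mathrm{Hom}_{\mathbb Z}(\mathrm{Dim}(A/C),\mathrm{Dim}(B/C)),$$ with transition for $C'\subseteq C$ given by $\phi\mapsto\phi\odot\mathrm{id}_{\mathrm{Dim}(C/C')}$ under $\mathrm{Dim}(A/C')=\mathrm{Dim}(A/C)\odot\mathrm{Dim}(C/C')$, and similarly for $B$. Composition gives $[[A|B]]\times[[B|C]]\to[[A|C]]$, written $(d,d')\mapsto d\odot d'$. An invertible $k$-linear $h$ with $hA\approx hB$ acts by $(h\circ d)(U)=d(h^{-1}U)$ on dimension theories and by conjugation $\phi\mapsto h\phi h^{-1}$ on homomorphisms, giving $h:[[A|B]]\to[[hA|hB]]$. $[[L|L]]$ contains the identity $\mathrm{id}$ and is identified with $\mathbb Z$ via $\mathrm{id}+n\mapsto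 n$. Central extension. $G_{V,L}$ is the set of pairs $(h,d)$, $h\in K^*$, $d\in[[L|hL]]$, with product $(h,d)(g,d')=(hg,\,d\odot(h\circ d'))$; its kernel over $K^*$ is $\{(1,d):d\in[[L|L]]\}\cong\mathbb Z$. For commuting $f,g$, choose lifts $\hat f,\hat g\in G_{V,L}$; $\hat f\hat g$ and $\hat g\hat f$ have the same first component $fg$, and $\psi_V(f,g)\in\mathbb Z$ is the unique integer $n$ such that the second component of $\hat f\hat g$ equals the second component of $\hat g\hat f$ shifted by $n$ in the $\mathbb Z$-torsor $[[L|fgL]]$ (it does not depend on the lifts). *)

(* Defs.v *)
From HB Require Import structures.
From mathcomp Require Import all_boot all_order all_algebra.
From Stdlib Require Import ClassicalEpsilon.
Set Implicit Arguments. Unset Strict Implicit. Unset Printing Implicit Defensive.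
Import Order.TTheory GRing.Theory Num.Theory.
Local Open Scope ring_scope.

Section TwoDimLocalField.
Variable k : fieldType.

(* K = k((t1))((t2)).  An element is its coefficient array            *)
(* a i j = coefficient of t2^i t1^j, with a i = 0 for i << 0 and each  *)
(* a i (an element of k((t1))) having support bounded below.           *)
Definition lbdd (F : int -> k) := exists M : int, forall j, j < M -> F j = 0.

Definition isK (a : int -> int -> k) :=
  (exists N : int, forall i, i < N -> forall j, a i j = 0) /\ (forall i, lbdd (a i)).

Record K := MkK { kc :> int -> int -> k; kcP : isK kc }.

Definition Kbnd2 (a : K) : int := proj1_sig (constructive_indefinite_description _ (proj1 (kcP a))).
Definition Kbnd1 (a : K) (i : int) : int :=
  proj1_sig (constructive_indefinite_description _ (proj2 (kcP a) i)).

Lemma Kbnd2P (a : K) i j : i < Kbnd2 a -> a i j = 0.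
Proof.
rewrite /Kbnd2; case: (constructive_indefinite_description _ _) => N HN /= Hi.
exact: HN.
Qed.

Lemma Kbnd1P (a : K) i j : j < Kbnd1 a i -> a i j = 0.
Proof.
rewrite /Kbnd1; case: (constructive_indefinite_description _ _) => N HN /= Hj.
exact: HN.
Qed.

Definition isum (lo hi : int) (F : int -> k) : k :=
  if lo <= hi then \sum_(t < (absz (hi - lo)%R).+1) F (lo + t%:Z) else 0.

Lemma lbdd_sum n (F : 'I_n -> int -> k) :
  (forall t, lbdd (F t)) -> lbdd (fun j => \sum_(t < n) F t j).
Proof.
elim: n F => [|n IH] F HF.
  by exists 0 => j _; rewrite big_ord0.
have [M1 H1] := IH (fun t => F (widen_ord (leqnSn n) t)) (fun t => HF _).
have [M2 H2] := HF ord_max.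
have [h|h] := lerP M1 M2.
- exists M1 => j hj; rewrite big_ord_recr /= H1 // H2 ?add0r //.
  exact: lt_le_trans hj h.
- exists M2 => j hj; rewrite big_ord_recr /= H1 ?H2 ?add0r //.
  exact: lt_trans hj h.
Qed.

Lemma isK0 : isK (fun _ _ => 0).
Proof. by split; [exists 0 | move=> i; exists 0]. Qed.
Definition K0 : K := MkK isK0.

Lemma isKadd (a b : K) : isK (fun i j => a i j + b i j).
Proof.
split.
  have [h|h] := lerP (Kbnd2 a) (Kbnd2 b).
  - exists (Kbnd2 a) => i hi j; rewrite !Kbnd2P ?addr0 //.
    exact: lt_le_trans hi h.
  - exists (Kbnd2 b) => i hi j; rewrite !Kbnd2P ?addr0 //.
    exact: lt_trans hi h.
move=> i; have [h|h] := lerP (Kbnd1 a i) (Kbnd1 b i).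
- exists (Kbnd1 a i) => j hj; rewrite !Kbnd1P ?addr0 //.
  exact: lt_le_trans hj h.
- exists (Kbnd1 b i) => j hj; rewrite !Kbnd1P ?addr0 //.
  exact: lt_trans hj h.
Qed.
Definition Kadd (a b : K) : K := MkK (isKadd a b).

Lemma isKscale (c : k) (a : K) : isK (fun i j => c * a i j).
Proof.
split; first by exists (Kbnd2 a) => i hi j; rewrite Kbnd2P ?mulr0.
by move=> i; exists (Kbnd1 a i) => j hj; rewrite Kbnd1P ?mulr0.
Qed.
Definition Kscale (c : k) (a : K) : K := MkK (isKscale c a).

Definition Kmulf (a b : K) (i j : int) : k :=
  isum (Kbnd2 a) (i - Kbnd2 b) (fun i1 =>
    isum (Kbnd1 a i1) (j - Kbnd1 b (i - i1)) (fun j1 =>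
      a i1 j1 * b (i - i1) (j - j1))).

Lemma isKmul (a b : K) : isK (Kmulf a b).
Proof.
split.
  exists (Kbnd2 a + Kbnd2 b) => i hi j; rewrite /Kmulf /isum.
  by rewrite lerBrDr leNgt hi.
move=> i; case: (boolP (Kbnd2 a <= i - Kbnd2 b)) => hc; last first.
  by exists 0 => j _; rewrite /Kmulf /isum (negbTE hc).
have -> : Kmulf a b i = fun j => \sum_(t < (absz (i - Kbnd2 b - Kbnd2 a)%R).+1)
    isum (Kbnd1 a (Kbnd2 a + t%:Z)) (j - Kbnd1 b (i - (Kbnd2 a + t%:Z)))
      (fun j1 => a (Kbnd2 a + t%:Z) j1 * b (i - (Kbnd2 a + t%:Z)) (j - j1)).
  by rewrite /Kmulf /isum hc.
apply: lbdd_sum => t.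
rewrite /lbdd.
set i1 := (Kbnd2 a + _).
exists (Kbnd1 a i1 + Kbnd1 b (i - i1)) => j hj.
have hj' : j - Kbnd1 b (i - i1) < Kbnd1 a i1 by rewrite ltrBlDr.
by rewrite /isum leNgt hj'.
Qed.
Definition Kmul (a b : K) : K := MkK (isKmul a b).

Definition is_nu2 (b : K) (i : int) :=
  (exists j, b i j <> 0) /\ (forall i', i' < i -> forall j, b i' j = 0).
Definition nu2 (b : K) : int := epsilon (inhabits 0) (is_nu2 b).
Definition is_nu1 (b : K) (j : int) :=
  b (nu2 b) j <> 0 /\ (forall j', j' < j -> b (nu2 b) j' = 0).
Definition nu1 (b : K) : int := epsilon (inhabits 0) (is_nu1 b).
Definition nuK (f g : K) : int := nu1 f * nu2 g - nu2 f * nu1 g.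

Definition subsp (U : K -> Prop) :=
  U K0 /\ (forall x y, U x -> U y -> U (Kadd x y)) /\ (forall c x, U x -> U (Kscale c x)).
Definition sub (U V : K -> Prop) := forall x, U x -> V x.
Definition inter (U V : K -> Prop) : K -> Prop := fun x => U x /\ V x.
Definition plus (U V : K -> Prop) : K -> Prop :=
  fun x => exists u v, U u /\ V v /\ x = Kadd u v.
Definition image (h : K) (U : K -> Prop) : K -> Prop := fun y => exists x, U x /\ y = Kmul h x.
Definition preim (h : K) (U : K -> Prop) : K -> Prop := fun x => U (Kmul h x).

Definition Ksum n (F : 'I_n -> K) : K := \big[Kadd/K0]_(i < n) F i.

Definition OK : K -> Prop := fun x => forall i j, i < 0 -> x i j = 0.
Definition isKbar (x : K) := forall i j, i != 0 -> x i j = 0.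
Definition isOt1 (x : K) := forall i j, (i != 0) || (j < 0) -> x i j = 0.

Definition OKmod (L : K -> Prop) :=
  L K0 /\ (forall x y, L x -> L y -> L (Kadd x y)) /\ (forall a x, OK a -> L x -> L (Kmul a x)).

(* O_K-lattice: nonzero proper O_K-submodule L with L (x)_{O_K} K = K,
   i.e. the multiplication map L (x) K -> K is onto (it is always injective). *)
Definition lattice (L : K -> Prop) :=
  OKmod L /\ (exists x, L x /\ x <> K0) /\ (exists x, ~ L x) /\
  (forall y, exists a l, L l /\ y = Kmul a l).

Definition approx (A B : K -> Prop) :=
  exists L M, lattice L /\ lattice M /\ sub L M /\
    sub L A /\ sub A M /\ sub L B /\ sub B M.

Definition lincomb n (c : 'I_n -> k) (x : 'I_n -> K) : K := Ksum (fun i => Kscale (c i) (x i)).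

Definition qdim (V U : K -> Prop) (n : nat) :=
  exists x : 'I_n -> K, (forall i, U (x i)) /\
    (forall c : 'I_n -> k, V (lincomb c x) -> forall i, c i = 0) /\
    (forall u, U u -> exists c : 'I_n -> k, V (Kadd u (Kscale (-1) (lincomb c x)))).

Definition commens (U1 U2 : K -> Prop) :=
  (exists n, qdim (inter U1 U2) U1 n) /\ (exists n, qdim (inter U1 U2) U2 n).

(* Lam is (the preimage in M of) a k[[t1]]-lattice of the finite-dimensional
   Kbar-space M/L: a finitely generated k[[t1]]-submodule of M/L spanning M/L
   over Kbar. *)
Definition t1lattice (L M Lam : K -> Prop) :=
  exists r (g : 'I_r -> K), (forall i, M (g i)) /\
    (forall x, Lam x <-> exists l (a : 'I_r -> K), L l /\ (forall i, isOt1 (a i)) /\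
                          x = Kadd l (Ksum (fun i => Kmul (a i) (g i)))) /\
    (forall m, M m -> exists l (b : 'I_r -> K), L l /\ (forall i, isKbar (b i)) /\
                          m = Kadd l (Ksum (fun i => Kmul (b i) (g i)))).

(* Gr(A/C): subspaces of A/C are represented by the k-subspaces U with
   C ⊆ U ⊆ A; the filtration of A/C is the one induced by the k[[t1]]-lattices
   of M/L, whose members are ((A ∩ Lam) + C)/C. *)
Definition GrQ (A C U : K -> Prop) :=
  subsp U /\ sub C U /\ sub U A /\
  exists L M Lam, lattice L /\ lattice M /\ sub L C /\ sub A M /\
    t1lattice L M Lam /\ commens U (plus (inter A Lam) C).

Definition dimfun := (K -> Prop) -> int.

Definition isDim (A C : K -> Prop) (d : dimfun) :=
  forall U1 U2, GrQ A C U1 -> GrQ A C U2 ->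
  forall n2 n1, qdim (inter U1 U2) U2 n2 -> qdim (inter U1 U2) U1 n1 ->
  d U2 = d U1 + n2%:Z - n1%:Z.

Definition eqDim (A C : K -> Prop) (d d' : dimfun) := forall U, GrQ A C U -> d U = d' U.

(* Dim(A/C) ⊙ Dim(C/C') -> Dim(A/C'),  U |-> e(U ∩ C) + a(U + C) *)
Definition odot (C : K -> Prop) (a e : dimfun) : dimfun :=
  fun U => e (inter U C) + a (plus U C).

Definition hact (h : K) (d : dimfun) : dimfun := fun U => d (preim h U).

Definition dshift (d : dimfun) (n : int) : dimfun := fun U => d U + n.

(* An element of [[A|B]] is represented at level C (C ⊆ A ∩ B, C ≈ A) by the
   Z-torsor homomorphism Dim(A/C) -> Dim(B/C) sending a to b. *)
Definition isRep (A B C : K -> Prop) (a b : dimfun) :=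
  subsp C /\ sub C A /\ sub C B /\ approx C A /\ isDim A C a /\ isDim B C b.

(* Graph, at a lower level C2 ⊆ C, of the transported homomorphism
   φ ⊙ id_{Dim(C/C2)} : Dim(A/C2) -> Dim(B/C2), where φ : a |-> b. *)
Definition graph (A B C : K -> Prop) (a b : dimfun) (C2 : K -> Prop) (al be : dimfun) :=
  exists e, isDim C C2 e /\ eqDim A C2 al (odot C a e) /\ eqDim B C2 be (odot C b e).

(* Lifts: (h, d) ∈ G_{V,L} with L = O_K, d ∈ [[L|hL]] represented by (C,a,b). *)
Definition isLift (h : K) (C : K -> Prop) (a b : dimfun) :=
  h <> K0 /\ isRep OK (image h OK) C a b.

(* second component of f^ g^ (= d_f ⊙ (f∘d_g)) equals second component of
   g^ f^ (= d_g ⊙ (g∘d_f)) shifted by n, in the torsor [[L|fgL]]. *)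
Definition commShift (f g : K) (C1 : K -> Prop) (a1 b1 : dimfun)
    (C2 : K -> Prop) (a2 b2 : dimfun) (n : int) :=
  let G1 := graph OK (image f OK) C1 a1 b1 in
  let G2 := graph (image f OK) (image f (image g OK)) (image f C2) (hact f a2) (hact f b2) in
  let G3 := graph OK (image g OK) C2 a2 b2 in
  let G4 := graph (image g OK) (image g (image f OK)) (image g C1) (hact g a1) (hact g b1) in
  exists C3, subsp C3 /\ sub C3 (inter C1 C2) /\ sub C3 (image f C2) /\
    sub C3 (image g C1) /\ approx C3 OK /\
    (exists al, isDim OK C3 al) /\
    forall al, isDim OK C3 al ->
      (exists be ga, G1 C3 al be /\ G2 C3 be ga) /\
      (exists be ga, G3 C3 al be /\ G4 C3 be ga) /\
      (forall be ga be' ga', G1 C3 al be -> G2 C3 be ga ->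
          G3 C3 al be' -> G4 C3 be' ga' ->
          eqDim (image f (image g OK)) C3 ga (dshift ga' n)).

Definition psiV (f g : K) (n : int) :=
  (exists C1 a1 b1 C2 a2 b2, isLift f C1 a1 b1 /\ isLift g C2 a2 b2) /\
  (forall C1 a1 b1 C2 a2 b2, isLift f C1 a1 b1 -> isLift g C2 a2 b2 ->
     commShift f g C1 a1 b1 C2 a2 b2 n).

End TwoDimLocalField.

(* Main.v *)
(* Every O_K-lattice is some t2^n O_K, and an element of [[A|B]] represented at
   level C is determined by the difference of the values of its two dimension
   theories at the reference subspaces A ∩ S + C and B ∩ S + C, where S consists
   of the series all of whose coefficients at negative powers of t1 vanish below
   t2^N, for one large N.  Comparing f^ g^ with g^ f^ at these points, all
   terms cancel except the effect of replacing S by f^-1 S (and by g^-1 S) on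
   the reference subspaces of O_K and g O_K (of O_K and f O_K).  By additivity of
   relative dimension the part of this effect inside C cancels too, and what
   remains is [S|f^-1 S] computed modulo t2^N inside g O_K minus the same inside
   O_K: multiplication by f being triangular for the t2-filtration, each power
   of t2 contributes nu1 f, and g O_K has nu2 g powers fewer.  Hence the
   commutator is - nu1 f * nu2 g + nu1 g * nu2 f. *)
From HB Require Import structures.
From mathcomp Require Import all_boot all_order all_algebra boolp zify ring.
From Stdlib Require Import ClassicalEpsilon.
Require Import Defs.
Set Implicit Arguments. Unset Strict Implicit. Unset Printing Implicit Defensive.
Import Order.TTheory GRing.Theory Num.Theory.
Local Open Scope ring_scope.

(** * Laurent series over a field *)

(** Neither term of the final difference has a meaning by itself: on t2^m O_K / t2^l O_K the index
    is nu1 f * (l - m), which grows with the arbitrary truncation l. Only the comparison of two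
    ambient lattices over one and the same l is intrinsic. The level C of a lift is an arbitrary
    subspace between two lattices, so the share of the index absorbed by C has no formula. It need
    not have one: it is computed inside C alone, hence is the same number for both ambient lattices.
    [GrQ] hides an existential choice of two O_K-lattices and a k[[t1]]-lattice. Every such
    k[[t1]]-lattice is caught between two boxes of monomials, so all choices give the same
    commensurability class, and a dimension theory is known from one value. Pulling subspaces back
    along f requires f^-1, while K is given as coefficient arrays multiplied through chosen,
    possibly crude, support bounds. Its field structure is therefore transported from Laurent series
    over Laurent series. *)

Lemma big_uniq_support (V : nmodType) (I : eqType) (s s' : seq I) (F : I -> V) :
  uniq s -> uniq s' ->
  (forall p, F p != 0 -> p \in s) -> (forall p, F p != 0 -> p \in s') ->
  \sum_(p <- s) F p = \sum_(p <- s') F p.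
Proof.
move=> us us' hs hs'.
have red r : \sum_(p <- r) F p = \sum_(p <- [seq p <- r | F p != 0]) F p.
  rewrite big_filter [LHS](bigID (fun p => F p != 0)) /= [X in _ + X]big1 ?addr0 //.
  by move=> p /negPn /eqP.
rewrite red [RHS]red; apply: perm_big; apply: uniq_perm; rewrite ?filter_uniq //.
move=> p; rewrite !mem_filter; case: (boolP (F p != 0)) => //= h.
by rewrite hs ?hs'.
Qed.

Definition zrange (lo hi : int) : seq int :=
  if lo <= hi then [seq lo + t%:Z | t <- iota 0 (absz (hi - lo)).+1] else [::].

Lemma mem_zrange lo hi p : (p \in zrange lo hi) = (lo <= p <= hi).
Proof.
rewrite /zrange; case: ifP => h; last first.
  by apply/esym/negbTE; lia.
apply/mapP/idP => [[t]|hp].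
  by rewrite mem_iota => ht ->; lia.
by exists (absz (p - lo)); rewrite ?mem_iota; lia.
Qed.

Lemma zrange_uniq lo hi : uniq (zrange lo hi).
Proof.
rewrite /zrange; case: ifP => // _; rewrite map_inj_uniq ?iota_uniq //.
by move=> a b /addrI [].
Qed.

Lemma isumE (F : fieldType) lo hi (f : int -> F) :
  isum lo hi f = \sum_(p <- zrange lo hi) f p.
Proof.
rewrite /isum /zrange; case: ifP => _; last by rewrite big_nil.
by rewrite big_map -(big_mkord xpredT (fun t => f (lo + t%:Z))) /index_iota subn0.
Qed.

Section Laurent.
Variable F : fieldType.

(** The coefficient field is generic because the construction is used twice: over k for the
    coefficient of one power of t2, and over [laurent k] for K itself. *)
Record laurent := Laurent { lcoef :> int -> F; lcoefP : lbdd lcoef }.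
Implicit Types a b c : laurent.

Lemma laurentP a b : (forall i, a i = b i) -> a = b.
Proof.
case: a b => [a Ha] [b Hb] /= /funext eab; case: _ / eab Hb => Hb.
by rewrite (Prop_irrelevance Ha Hb).
Qed.

HB.instance Definition _ := gen_eqMixin laurent.
HB.instance Definition _ := gen_choiceMixin laurent.

Lemma lbdd0 : lbdd (fun _ => 0 : F).
Proof. by exists 0. Qed.
Lemma lbdd_opp a : lbdd (fun i => - a i).
Proof. by case: (lcoefP a) => M h; exists M => j /h ->; rewrite oppr0. Qed.
Lemma lbdd_add a b : lbdd (fun i => a i + b i).
Proof.
case: (lcoefP a) (lcoefP b) => [M h] [N h'].
by exists (Num.min M N) => j; rewrite lt_min => /andP[hM hN]; rewrite h ?h' ?addr0.
Qed.

Definition lau_add a b := Laurent (lbdd_add a b).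
Definition lau_opp a := Laurent (lbdd_opp a).

Fact lau_addA : associative lau_add.
Proof. by move=> a b c; apply: laurentP => i /=; rewrite addrA. Qed.
Fact lau_addC : commutative lau_add.
Proof. by move=> a b; apply: laurentP => i /=; rewrite addrC. Qed.
Fact lau_add0 : left_id (Laurent lbdd0) lau_add.
Proof. by move=> a; apply: laurentP => i /=; rewrite add0r. Qed.
Fact lau_addN : left_inverse (Laurent lbdd0) lau_opp lau_add.
Proof. by move=> a; apply: laurentP => i /=; rewrite addNr. Qed.
HB.instance Definition _ :=
  GRing.isZmodule.Build laurent lau_addA lau_addC lau_add0 lau_addN.

Lemma lau_sumE (I : Type) (r : seq I) (P : pred I) (G : I -> laurent) i :
  (\sum_(t <- r | P t) G t) i = \sum_(t <- r | P t) G t i.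
Proof. by elim/big_rec2: _ => // t u v _ <-. Qed.

Definition lbnd a := proj1_sig (constructive_indefinite_description _ (lcoefP a)).
Lemma lbndP a i : i < lbnd a -> a i = 0.
Proof. by rewrite /lbnd; case: constructive_indefinite_description => N h /=; apply: h. Qed.

Definition lmulf a b i := isum (lbnd a) (i - lbnd b) (fun p => a p * b (i - p)).

(** Terms outside the chosen bounds vanish, so any duplicate-free list covering the nonzero terms
    gives the same sum. This removes the arbitrary bounds from every later computation. *)
Lemma lmulfE a b i s : uniq s -> (forall p, a p * b (i - p) != 0 -> p \in s) ->
  lmulf a b i = \sum_(p <- s) a p * b (i - p).
Proof.
move=> us hs; rewrite /lmulf isumE; apply: big_uniq_support => // [|p].
  exact: zrange_uniq.
apply: contraNT; rewrite mem_zrange negb_and => /orP[h|h].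
  by rewrite lbndP ?mul0r // ltNge.
by rewrite (@lbndP b) ?mulr0 //; lia.
Qed.

Lemma lbdd_mul a b : lbdd (lmulf a b).
Proof.
exists (lbnd a + lbnd b) => j hj; rewrite /lmulf /isum ifF //.
by apply/negbTE; lia.
Qed.
Definition lau_mul a b := Laurent (lbdd_mul a b).

Lemma lbdd1 : lbdd (fun i => (i == 0)%:R : F).
Proof. by exists 0 => j hj; rewrite lt_eqF. Qed.
Definition lau1 := Laurent lbdd1.

Fact lau_mulC : commutative lau_mul.
Proof.
move=> a b; apply: laurentP => i /=.
rewrite (@lmulfE a b i (zrange (lbnd a) (i - lbnd b))) ?zrange_uniq //; last first.
  move=> p; apply: contraNT; rewrite mem_zrange negb_and => /orP[h|h].
    by rewrite lbndP ?mul0r // ltNge.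
  by rewrite (@lbndP b) ?mulr0 //; lia.
rewrite (@lmulfE b a i [seq i - q | q <- zrange (lbnd a) (i - lbnd b)]).
- by rewrite big_map; apply: eq_bigr => q _; rewrite subKr mulrC.
- rewrite map_inj_uniq ?zrange_uniq // => p q /addrI /oppr_inj //.
- move=> p hp; apply/mapP; exists (i - p); last by rewrite subKr.
  apply: contraNT hp; rewrite mem_zrange negb_and => /orP[h|h].
    by rewrite (@lbndP a) ?mulr0 // ltNge.
  by rewrite (@lbndP b) ?mul0r //; lia.
Qed.

Lemma lau_mul_bnd a b j : j < lbnd a + lbnd b -> lau_mul a b j = 0.
Proof.
move=> hj; rewrite /= /lmulf /isum ifF //.
by apply/negbTE; lia.
Qed.

Fact lau_mulA : associative lau_mul.
Proof.
move=> a b c; apply: laurentP => i.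
set A := lbnd a; set B := lbnd b; set C := lbnd c.
(* [s] contains the possible degrees m in a * b, [s'] the possible degrees p in a. Both products
   become the double sum of a p * b (m - p) * c (i - m) over these windows. *)
pose s := zrange (A + B) (i - C); pose s' := zrange A (i - C - B).
have -> : lau_mul (lau_mul a b) c i = \sum_(m <- s) lau_mul a b m * c (i - m).
  apply: lmulfE; rewrite ?zrange_uniq // => m; apply: contraNT.
  rewrite mem_zrange negb_and => /orP[h|h].
    by rewrite lau_mul_bnd ?mul0r // -/A -/B; lia.
  by rewrite (@lbndP c) ?mulr0 // -/C; lia.
have -> : lau_mul a (lau_mul b c) i = \sum_(p <- s') a p * lau_mul b c (i - p).
  apply: lmulfE; rewrite ?zrange_uniq // => m; apply: contraNT.
  rewrite mem_zrange negb_and => /orP[h|h].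
    by rewrite lbndP ?mul0r // -/A; lia.
  by rewrite lau_mul_bnd ?mulr0 // -/B -/C; lia.
under [RHS]eq_big_seq => m.
  rewrite mem_zrange => hm.
  have -> : lau_mul a b m = \sum_(p <- s') a p * b (m - p).
    apply: lmulfE; rewrite ?zrange_uniq // => p; apply: contraNT.
    rewrite mem_zrange negb_and => /orP[h|h].
      by rewrite lbndP ?mul0r // -/A; lia.
    by rewrite (@lbndP b) ?mulr0 // -/B; lia.
  rewrite mulr_suml; over.
rewrite exchange_big /=; apply: eq_big_seq => p; rewrite mem_zrange => hp.
have -> : lmulf b c (i - p) =
    \sum_(q <- [seq m - p | m <- s]) b q * c (i - p - q).
  apply: lmulfE; first by rewrite map_inj_uniq ?zrange_uniq // => u v /addIr.
  move=> q hq; apply/mapP; exists (q + p); last by rewrite addrK.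
  apply: contraNT hq; rewrite mem_zrange negb_and => /orP[h|h].
    by rewrite (@lbndP b) ?mul0r // -/B; lia.
  by rewrite (@lbndP c) ?mulr0 // -/C; lia.
rewrite big_map mulr_sumr; apply: eq_bigr => m _.
by rewrite mulrA; congr (_ * c _); lia.
Qed.

Fact lau_mul1 : left_id lau1 lau_mul.
Proof.
move=> a; apply: laurentP => i /=; rewrite (@lmulfE lau1 a i [:: 0]) //=.
  by rewrite big_seq1 eqxx mul1r subr0.
by move=> p; apply: contraNT; rewrite inE => /negbTE ->; rewrite mul0r.
Qed.

Fact lau_mulDl : left_distributive lau_mul lau_add.
Proof.
move=> a b c; apply: laurentP => i /=.
have [lo la lb] : exists2 lo, lo <= lbnd a & lo <= lbnd b.
  by exists (Num.min (lbnd a) (lbnd b)); rewrite ge_min lexx ?orbT.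
pose s := zrange lo (i - lbnd c).
have hs (d : laurent) : lo <= lbnd d ->
    lmulf d c i = \sum_(p <- s) d p * c (i - p).
  move=> hd; apply: lmulfE; rewrite ?zrange_uniq // => p; apply: contraNT.
  rewrite mem_zrange negb_and => /orP[h|h]; first by rewrite lbndP ?mul0r //; lia.
  by rewrite (@lbndP c) ?mulr0 //; lia.
rewrite (hs a) // (hs b) // -big_split /=.
rewrite (@lmulfE (lau_add a b) c i s) ?zrange_uniq //.
  by apply: eq_bigr => p _; rewrite mulrDl.
move=> p; apply: contraNT.
rewrite mem_zrange negb_and => /orP[h|h] /=; first by rewrite (@lbndP a) ?(@lbndP b) ?addr0 ?mul0r //; lia.
by rewrite (@lbndP c) ?mulr0 //; lia.
Qed.

Fact lau_oner_neq0 : lau1 != 0.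
Proof.
apply/eqP => /(congr1 (fun x : laurent => x 0)) /eqP /=.
by rewrite oner_eq0.
Qed.

HB.instance Definition _ := GRing.Zmodule_isComNzRing.Build laurent
  lau_mulA lau_mulC lau_mul1 lau_mulDl lau_oner_neq0.

Lemma lauME a b i s : uniq s -> (forall p, a p * b (i - p) != 0 -> p \in s) ->
  (a * b) i = \sum_(p <- s) a p * b (i - p).
Proof. exact: lmulfE. Qed.

Lemma lau1E i : (1 : laurent) i = (i == 0)%:R. Proof. by []. Qed.

Definition lau_vanish a (n : int) := forall i, i < n -> a i = 0.

Lemma lau_vanishM a b m n : lau_vanish a m -> lau_vanish b n -> lau_vanish (a * b) (m + n).
Proof.
move=> ha hb i hi; rewrite (@lauME a b i [::]) ?big_nil // => p; apply: contraNT => _.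
have [h|h] := ltP p m; first by rewrite ha // mul0r.
by rewrite hb ?mulr0 //; lia.
Qed.

Lemma lau_lead a b m n : lau_vanish a m -> lau_vanish b n -> (a * b) (m + n) = a m * b n.
Proof.
move=> ha hb; rewrite (@lauME a b _ [:: m]) //=.
  by rewrite big_seq1; congr (_ * b _); lia.
move=> p; apply: contraNT; rewrite inE neq_lt => /orP[h|h]; first by rewrite ha // mul0r.
by rewrite hb ?mulr0 //; lia.
Qed.

Lemma lau_valP a : a != 0 -> exists v, a v != 0 /\ lau_vanish a v.
Proof.
move=> a0; have [M hM] := lcoefP a.
have ex : exists n : nat, a (M + n%:Z) != 0.
  apply/not_existsP => h; case/negP: a0; apply/eqP/laurentP => i.
  have [/hM //|hi] := ltP i M.
  have := h (absz (i - M)); have -> : M + `|i - M|%N = i by lia.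
  by move=> /negP; rewrite negbK => /eqP.
exists (M + (ex_minn ex)%:Z); case: ex_minnP => n hn mn; split=> // i hi.
have [/hM //|hiM] := ltP i M.
apply/eqP; apply: contraT => h; have := mn (absz (i - M)).
have -> : M + `|i - M|%N = i by lia.
by move=> /(_ h); lia.
Qed.

(* The coefficients of the inverse of a series whose coefficients from the
   lowest one on are u 0, u 1, ... *)
Fixpoint inv_coefs (u : nat -> F) (n : nat) : seq F :=
  if n is m.+1 then
    let s := inv_coefs u m in
    rcons s (((m == 0)%:R - \sum_(t < m) s`_t * u (m - t)%N) / u 0)
  else [::].

Lemma size_inv_coefs u n : size (inv_coefs u n) = n.
Proof. by elim: n => //= n IH; rewrite size_rcons IH. Qed.

Lemma nth_inv_coefs u n t : (t < n)%N -> (inv_coefs u n)`_t = (inv_coefs u t.+1)`_t.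
Proof.
elim: n => // n IH; rewrite ltnS leq_eqVlt => /orP[/eqP -> //|h].
by rewrite [LHS]/= nth_rcons size_inv_coefs h IH.
Qed.

Lemma inv_coefsP u n : u 0 != 0 ->
  \sum_(t < n.+1) (inv_coefs u t.+1)`_t * u (n - t)%N = (n == 0)%:R.
Proof.
move=> u0; rewrite big_ord_recr /= nth_rcons size_inv_coefs ltnn eqxx subnn divfK //.
under eq_bigr => t _ do rewrite -(@nth_inv_coefs u n t) //.
by rewrite addrC subrK.
Qed.

Lemma lau_inv_ex a : a != 0 -> exists b, b * a = 1.
Proof.
move=> /lau_valP [v [av va]]; pose u (n : nat) := a (v + n%:Z).
have bb : lbdd (fun i : int => if - v <= i then (inv_coefs u `|i + v|.+1)`_(`|i + v|) else 0).
  by exists (- v) => i hi; rewrite leNgt hi.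
exists (Laurent bb); apply: laurentP => i.
have -> : (Laurent bb * a) i = isum (- v) (i - v) (fun p => Laurent bb p * a (i - p)).
  rewrite isumE; apply: lauME; rewrite ?zrange_uniq // => p.
  apply: contraNT; rewrite mem_zrange negb_and => /orP[h|h] /=.
    by rewrite (negbTE h) mul0r.
  by rewrite va ?mulr0 //; lia.
(* The range from -v to i - v is empty for i < 0 and has i + 1 terms otherwise, as [inv_coefsP]
   requires. *)
rewrite lau1E /isum; case: ifP => hi; last first.
  by have -> : (i == 0) = false by lia.
have -> : (i - v - - v) = i by lia.
have -> : (i == 0) = (`|i|%N == 0) by lia.
rewrite -(@inv_coefsP u `|i|) /u ?addr0 //; apply: eq_bigr => t _ /=.
rewrite lerDl lez_nat leq0n.
have -> : absz (- v + t%:Z + v) = t by lia.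
by congr (_ * a _); have := ltn_ord t; lia.
Qed.

Definition lau_inv a : laurent :=
  if a == 0 then 0 else epsilon (inhabits 0) (fun b => b * a = 1).

Fact lau_mulV a : a != 0 -> lau_inv a * a = 1.
Proof.
move=> a0; rewrite /lau_inv (negbTE a0).
exact: (epsilon_spec _ _ (lau_inv_ex a0)).
Qed.
Fact lau_inv0 : lau_inv 0 = 0.
Proof. by rewrite /lau_inv eqxx. Qed.

HB.instance Definition _ := GRing.ComNzRing_isField.Build laurent lau_mulV lau_inv0.

End Laurent.

(** * The field k((t1))((t2)) *)

Section KField.
Variable k : fieldType.
Implicit Types a b c : K k.

Lemma Kext a b : (forall i j, a i j = b i j) -> a = b.
Proof.
case: a b => [a Ha] [b Hb] /= h.
have eab : a = b by apply: funext => i; apply: funext.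
by case: _ / eab Hb => Hb; rewrite (Prop_irrelevance Ha Hb).
Qed.

Definition row a (i : int) : laurent k := Laurent ((kcP a).2 i).

Lemma lbdd_row a : lbdd (row a).
Proof.
by case: (kcP a).1 => N h; exists N => i hi; apply: laurentP => j; apply: h.
Qed.
Definition rows a : laurent (laurent k) := Laurent (lbdd_row a).

Lemma isK_of_rows (A : laurent (laurent k)) : isK (fun i j => A i j).
Proof.
split; last by move=> i; apply: lcoefP.
by case: (lcoefP A) => N h; exists N => i hi j; rewrite h.
Qed.
Definition of_rows A : K k := MkK (isK_of_rows A).

Lemma rowsK : cancel rows of_rows. Proof. by move=> a; apply: Kext. Qed.
Lemma of_rowsK : cancel of_rows rows.
Proof. by move=> A; apply: laurentP => i; apply: laurentP. Qed.
Definition rows_inj := can_inj rowsK.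

HB.instance Definition _ := gen_eqMixin (K k).
HB.instance Definition _ := gen_choiceMixin (K k).

(** The given product on K is the product of iterated Laurent series. As [rows] is injective, the
    ring axioms and inverses are pulled back along it. *)
Lemma rowsM a b : rows (Kmul a b) = rows a * rows b.
Proof.
apply: laurentP => i; apply: laurentP => j.
rewrite (@lauME _ _ _ _ (zrange (Kbnd2 a) (i - Kbnd2 b))) ?zrange_uniq //; last first.
  move=> p; apply: contraNT; rewrite mem_zrange negb_and => /orP[h|h].
    have -> : rows a p = 0 by apply: laurentP => t; apply: Kbnd2P; rewrite ltNge.
    by rewrite mul0r.
  have -> : rows b (i - p) = 0 by apply: laurentP => t; apply: Kbnd2P; lia.
  by rewrite mulr0.
rewrite lau_sumE -[LHS]/(Kmulf a b i j) /Kmulf isumE; apply: eq_bigr => p _.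
rewrite isumE (@lauME _ _ _ _ (zrange (Kbnd1 a p) (j - Kbnd1 b (i - p)))) ?zrange_uniq //.
move=> q; apply: contraNT; rewrite mem_zrange negb_and => /orP[h|h] /=.
  by rewrite (Kbnd1P (a := a)) ?mul0r // ltNge.
by rewrite (@Kbnd1P _ b (i - p)) ?mulr0 //; move: h; rewrite -ltNge; lia.
Qed.

Fact KaddA : associative (@Kadd k).
Proof. by move=> a b c; apply: Kext => i j /=; rewrite addrA. Qed.
Fact KaddC : commutative (@Kadd k).
Proof. by move=> a b; apply: Kext => i j /=; rewrite addrC. Qed.
Fact Kadd0 : left_id (K0 k) (@Kadd k).
Proof. by move=> a; apply: Kext => i j /=; rewrite add0r. Qed.
(** Taking [Kscale (-1)] as the opposite makes the difference written in [qdim] convertible to a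
    subtraction in the ring. *)
Fact KaddN : left_inverse (K0 k) (Kscale (-1)) (@Kadd k).
Proof. by move=> a; apply: Kext => i j /=; rewrite mulN1r addNr. Qed.
HB.instance Definition _ := GRing.isZmodule.Build (K k) KaddA KaddC Kadd0 KaddN.

Lemma rowsD a b : rows (a + b) = rows a + rows b.
Proof. by apply: laurentP => i; apply: laurentP. Qed.
Lemma rows0 : rows 0 = 0.
Proof. by apply: laurentP => i; apply: laurentP. Qed.

Fact KmulA : associative (@Kmul k).
Proof. by move=> a b c; apply: rows_inj; rewrite !rowsM mulrA. Qed.
Fact KmulC : commutative (@Kmul k).
Proof. by move=> a b; apply: rows_inj; rewrite !rowsM mulrC. Qed.
Fact Kmul1 : left_id (of_rows 1) (@Kmul k).
Proof. by move=> a; apply: rows_inj; rewrite rowsM of_rowsK mul1r. Qed.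
Fact KmulDl : left_distributive (@Kmul k) (@Kadd k).
Proof. by move=> a b c; apply: rows_inj; rewrite !(rowsM, rowsD) mulrDl. Qed.
Fact Koner_neq0 : of_rows 1 != 0.
Proof. by apply/eqP => /(congr1 rows); rewrite of_rowsK rows0 => /eqP; rewrite oner_eq0. Qed.
HB.instance Definition _ := GRing.Zmodule_isComNzRing.Build (K k)
  KmulA KmulC Kmul1 KmulDl Koner_neq0.

Definition Kinv a := of_rows (rows a)^-1.
Fact KmulV a : a != 0 -> Kinv a * a = 1.
Proof.
move=> a0; apply: rows_inj; rewrite rowsM /Kinv !of_rowsK mulVf //.
by apply: contra a0 => /eqP e; apply/eqP/rows_inj; rewrite e rows0.
Qed.
Fact Kinv0 : Kinv 0 = 0.
Proof. by apply: rows_inj; rewrite of_rowsK rows0 invr0. Qed.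
HB.instance Definition _ := GRing.ComNzRing_isField.Build (K k) KmulV Kinv0.

Fact KscaleA (c d : k) a : Kscale c (Kscale d a) = Kscale (c * d) a.
Proof. by apply: Kext => i j /=; rewrite mulrA. Qed.
Fact Kscale1 : left_id 1 (@Kscale k).
Proof. by move=> a; apply: Kext => i j /=; rewrite mul1r. Qed.
Fact KscaleDr : right_distributive (@Kscale k) +%R.
Proof. by move=> c a b; apply: Kext => i j /=; rewrite mulrDr. Qed.
Fact KscaleDl a : {morph (@Kscale k)^~ a : c d / c + d >-> c + d}.
Proof. by move=> c d; apply: Kext => i j /=; rewrite mulrDl. Qed.
HB.instance Definition _ := GRing.Zmodule_isLmodule.Build k (K k)
  KscaleA Kscale1 KscaleDr KscaleDl.

Lemma row_coef a i j : row a i j = a i j. Proof. by []. Qed.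
Lemma KDE a b i j : (a + b) i j = a i j + b i j. Proof. by []. Qed.
Lemma KNE a i j : (- a) i j = - a i j. Proof. by rewrite /= mulN1r. Qed.
Lemma KZE (c : k) a i j : (c *: a) i j = c * a i j. Proof. by []. Qed.
Lemma K_sumE (I : Type) (r : seq I) (P : pred I) (G : I -> K k) i j :
  (\sum_(t <- r | P t) G t) i j = \sum_(t <- r | P t) G t i j.
Proof. by elim/big_rec2: _ => // t u v _ <-. Qed.

Lemma KaddE a b : Kadd a b = a + b. Proof. by []. Qed.
Lemma KmulE a b : Kmul a b = a * b. Proof. by []. Qed.
Lemma KscaleE (c : k) a : Kscale c a = c *: a. Proof. by []. Qed.

Lemma rowM a b i s : uniq s ->
  (forall p, row a p * row b (i - p) != 0 -> p \in s) ->
  row (a * b) i = \sum_(p <- s) row a p * row b (i - p).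
Proof.
move=> us hs; transitivity (rows (a * b) i); first by apply: laurentP.
by rewrite rowsM; apply: lauME.
Qed.

Lemma KscalerAl (c : k) a b : c *: (a * b) = (c *: a) * b.
Proof.
apply: rows_inj; apply: laurentP => i; apply: laurentP => j.
have hs p : p \notin zrange (Kbnd2 a) (i - Kbnd2 b) -> row a p = 0 \/ row b (i - p) = 0.
  rewrite mem_zrange negb_and => /orP[h|h]; [left|right]; apply: laurentP => t;
    apply: Kbnd2P; lia.
rewrite -[LHS]/(c * row (a * b) i j) -[RHS]/(row ((c *: a) * b) i j).
rewrite !(@rowM _ _ i (zrange (Kbnd2 a) (i - Kbnd2 b))) ?zrange_uniq //; last first.
- by move=> p; apply: contraNT => /hs [->|->]; rewrite ?mul0r ?mulr0.
- move=> p; apply: contraNT => /hs [e|->]; rewrite ?mulr0 //.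
  have -> : row (c *: a) p = 0.
    by apply: laurentP => t; rewrite /= -(row_coef a) e mulr0.
  by rewrite mul0r.
rewrite !lau_sumE mulr_sumr; apply: eq_bigr => p _.
pose s := zrange (Kbnd1 a p) (j - Kbnd1 b (i - p)).
have ht q : q \notin s -> row a p q = 0 \/ row b (i - p) (j - q) = 0.
  rewrite mem_zrange negb_and => /orP[h|h]; [left|right]; apply: Kbnd1P; lia.
rewrite !(@lauME _ _ _ j s) ?zrange_uniq //; last first.
- by move=> q; apply: contraNT => /ht [->|->]; rewrite ?mul0r ?mulr0.
- by move=> q; apply: contraNT => /ht /= [->|->]; rewrite ?mulr0 ?mul0r.
by rewrite mulr_sumr; apply: eq_bigr => q _ /=; rewrite mulrA.
Qed.

End KField.

(** * Relative dimension of commensurable subspaces *)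

Section RelativeDimension.
Variable k : fieldType.
Implicit Types (U V W C : K k -> Prop) (x y : K k).

Lemma set_ext U V : sub U V -> sub V U -> U = V.
Proof. by move=> h1 h2; apply: funext => x; apply: propext; split; [apply: h1|apply: h2]. Qed.

Lemma subsp0 U : subsp U -> U 0. Proof. by case. Qed.
Lemma subspD U x y : subsp U -> U x -> U y -> U (x + y).
Proof. by case=> _ [h _]; apply: h. Qed.
Lemma subspZ U (c : k) x : subsp U -> U x -> U (c *: x).
Proof. by case=> _ [_ h]; apply: h. Qed.
Lemma subspN U x : subsp U -> U x -> U (- x).
Proof. by move=> hU hx; rewrite -scaleN1r; apply: subspZ. Qed.
Lemma subspB U x y : subsp U -> U x -> U y -> U (x - y).
Proof. by move=> hU hx hy; apply: subspD => //; apply: subspN. Qed.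
Lemma subsp_sum U (I : Type) (r : seq I) (G : I -> K k) :
  subsp U -> (forall i, U (G i)) -> U (\sum_(i <- r) G i).
Proof.
move=> hU hG; elim/big_rec: _ => [|i x _ hx]; first exact: subsp0.
exact: subspD.
Qed.

Lemma subsp_inter U V : subsp U -> subsp V -> subsp (inter U V).
Proof.
move=> hU hV; split; first by split; apply: subsp0.
split=> [x y [? ?] [? ?]|c x [? ?]]; split; by [apply: subspD|apply: subspZ].
Qed.

Lemma subsp_plus U V : subsp U -> subsp V -> subsp (plus U V).
Proof.
move=> hU hV; split.
  by exists 0, 0; split; [|split]; rewrite ?KaddE ?addr0 //; apply: subsp0.
split.
  move=> _ _ [u [v [hu [hv ->]]]] [u' [v' [hu' [hv' ->]]]].
  exists (u + u'), (v + v'); split; first exact: subspD.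
  by split; [exact: subspD|rewrite !KaddE addrACA].
move=> c _ [u [v [hu [hv ->]]]]; exists (c *: u), (c *: v).
by split; [exact: subspZ|split; [exact: subspZ|rewrite !KaddE KscaleE scalerDr]].
Qed.

Lemma plusP U V x y : U x -> V y -> plus U V (x + y).
Proof. by move=> hx hy; exists x, y. Qed.
Lemma sub_plusl U V : subsp V -> sub U (plus U V).
Proof. by move=> hV x hx; rewrite -[x]addr0; apply: plusP => //; apply: subsp0. Qed.
Lemma sub_plusr U V : subsp U -> sub V (plus U V).
Proof. by move=> hU x hx; rewrite -[x]add0r; apply: plusP => //; apply: subsp0. Qed.
Lemma plus_sub U V W : subsp W -> sub U W -> sub V W -> sub (plus U V) W.
Proof. by move=> hW hU hV _ [u [v [hu [hv ->]]]]; apply: subspD; auto. Qed.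
Lemma plusS U U' V V' : sub U U' -> sub V V' -> sub (plus U V) (plus U' V').
Proof. by move=> h h' _ [u [v [hu [hv ->]]]]; exists u, v; auto. Qed.
Lemma inter_sub U V W : sub W U -> sub W V -> sub W (inter U V).
Proof. by move=> h1 h2 x hx; split; auto. Qed.
Lemma inter_absorb U V : sub U V -> inter U V = U.
Proof. by move=> h; apply: set_ext => [x []//|x hx]; split; auto. Qed.

Lemma inter_absorbr U V : sub V U -> inter U V = V.
Proof. by move=> h; apply: set_ext => [x []//|x hx]; split; auto. Qed.
Lemma interC U V : inter U V = inter V U.
Proof. by apply: set_ext => x []. Qed.

Lemma modular U V C : subsp C -> sub V C ->
  inter (plus U V) C = plus (inter U C) V.
Proof.
move=> hC hV; apply: set_ext => x.
  case=> [[u [v [hu [hv ->]]]]] hc; exists u, v; split=> //; split=> //.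
  by rewrite -[u](addrK v); apply: subspB => //; apply: hV.
case=> u [v [[hu hc] [hv ->]]]; split; first by exists u, v.
by apply: subspD => //; apply: hV.
Qed.

Definition indep V n (z : 'I_n -> K k) :=
  forall c : 'I_n -> k, V (\sum_i c i *: z i) -> forall i, c i = 0.

Lemma qdimP V U n : qdim V U n <->
  exists z : 'I_n -> K k, (forall i, U (z i)) /\ indep V z /\
    (forall u, U u -> exists c : 'I_n -> k, V (u - \sum_i c i *: z i)).
Proof.
by split=> [] [z h]; exists z.
Qed.

(** With more y's than x's the coefficient matrix has a nonzero left kernel vector, and this is a
    dependence of the y's modulo V. *)
Lemma indep_le V n m (x : 'I_n -> K k) (y : 'I_m -> K k) : subsp V ->
  (forall j, exists c : 'I_n -> k, V (y j - \sum_i c i *: x i)) ->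
  indep V y -> (m <= n)%N.
Proof.
move=> hV /choice [A hA] iy; rewrite leqNgt; apply/negP => lt_nm.
pose M := \matrix_(j < m, i < n) A j i.
have : kermx M != 0.
  by rewrite kermx_eq0 /row_free; apply/negP => /eqP e; have := rank_leq_col M; lia.
case/rowV0Pn => v /sub_kermxP vM /eqP; apply; apply/rowP => j; rewrite mxE.
apply: (iy (fun j => v 0 j)) j.
have -> : \sum_j v 0 j *: y j = \sum_j v 0 j *: (y j - \sum_i A j i *: x i).
  under [RHS]eq_bigr do rewrite scalerBr; rewrite big_split /= sumrN.
  suff -> : \sum_j v 0 j *: (\sum_i A j i *: x i) = 0 by rewrite subr0.
  under eq_bigr => j _ do rewrite scaler_sumr.
  rewrite exchange_big /= big1 // => i _.
  under eq_bigr => j _ do rewrite scalerA.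
  rewrite -scaler_suml; have /matrixP /(_ 0 i) := vM; rewrite !mxE.
  by under eq_bigr => j _ do rewrite mxE; move=> ->; rewrite scale0r.
by apply: subsp_sum => // j; apply: subspZ.
Qed.

Lemma qdim_uniq V U m n : subsp V -> qdim V U m -> qdim V U n -> m = n.
Proof.
move=> hV /qdimP [x [xU [ix gx]]] /qdimP [y [yU [iy gy]]]; apply/eqP.
by rewrite eqn_leq (@indep_le V _ _ y x) ?(@indep_le V _ _ x y) // => j; auto.
Qed.

Lemma qdim_refl V : subsp V -> qdim V V 0.
Proof.
move=> hV; apply/qdimP; exists (fun=> 0); split; first by case.
split; first by move=> c _; case.
by move=> u hu; exists (fun=> 0); rewrite big_ord0 subr0.
Qed.

Lemma qdim_trans V W U a b : subsp W -> sub V W -> sub W U ->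
  qdim V W a -> qdim W U b -> qdim V U (a + b)%N.
Proof.
move=> hW VW WU /qdimP [x [xW [ix gx]]] /qdimP [y [yU [iy gy]]]; apply/qdimP.
pose z (i : 'I_(a + b)) := match split i with inl i => x i | inr i => y i end.
have spl i : split (lshift b i) = inl i := @unsplitK a b (inl i).
have spr i : split (rshift a i) = inr i := @unsplitK a b (inr i).
have zl i : z (lshift b i) = x i by rewrite /z spl.
have zr i : z (rshift a i) = y i by rewrite /z spr.
have zsum (c : 'I_(a + b) -> k) : \sum_i c i *: z i =
    \sum_i c (lshift b i) *: x i + \sum_i c (rshift a i) *: y i.
  rewrite big_split_ord /=; congr (_ + _); apply: eq_bigr => i _; by rewrite ?zl ?zr.
have xsum (c : 'I_a -> k) : W (\sum_i c i *: x i).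
  by apply: subsp_sum => // i; apply: subspZ.
exists z; split; first by move=> i; rewrite /z; case: (split i) => j; auto.
split=> [c|u /gy [d hd]].
  rewrite zsum => hc.
  have hr i : c (rshift a i) = 0.
    apply: (iy (fun i => c (rshift a i))); have := subspB hW (VW _ hc) (xsum (fun i => c (lshift b i))).
    by rewrite addrC addKr.
  have hl i : c (lshift b i) = 0.
    apply: (ix (fun i => c (lshift b i))); move: hc; rewrite [X in _ + X]big1 ?addr0 //.
    by move=> j _; rewrite hr scale0r.
  by move=> i; case: (splitP i) => j e; rewrite (_ : i = lshift b j) || rewrite (_ : i = rshift a j);
    rewrite ?hl ?hr //; apply: val_inj.
have [c hc] := gx _ hd.
exists (fun i => match split i with inl i => c i | inr i => d i end).
rewrite zsum opprD addrA addrAC.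
rewrite (eq_bigr (fun i => c i *: x i)) => [|i _]; last by rewrite spl.
rewrite [X in _ - X - _](eq_bigr (fun i => d i *: y i)) // => i _.
by rewrite spr.
Qed.

(** An independent family of maximal size spans: adjoining any u of W creates a dependence, and u
    occurs in it with nonzero coefficient because the family alone is independent. *)
Lemma qdim_max V W n : subsp V ->
  (forall m (y : 'I_m -> K k), (forall i, W (y i)) -> indep V y -> (m <= n)%N) ->
  exists a, qdim V W a.
Proof.
move=> hV hn.
pose P a := `[< exists y : 'I_a -> K k, (forall i, W (y i)) /\ indep V y >].
have P0 : exists a, P a.
  by exists 0; apply/asboolP; exists (fun=> 0); split; [case|move=> c _; case].
have Pn a : P a -> (a <= n)%N by move=> /asboolP [y [yW iy]]; apply: hn iy.
exists (ex_maxn P0 Pn); case: ex_maxnP => a /asboolP [x [xW ix]] mx.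
apply/qdimP; exists x; split=> //; split=> // u hu.
pose z (i : 'I_a.+1) := if unlift ord0 i is Some j then x j else u.
have zsum (c : 'I_a.+1 -> k) : \sum_i c i *: z i =
    c ord0 *: u + \sum_i c (lift ord0 i) *: x i.
  rewrite big_ord_recl /z unlift_none; congr (_ + _).
  by apply: eq_bigr => i _; rewrite liftK.
have [c [hc [i ci]]] : exists c : 'I_a.+1 -> k, V (\sum_i c i *: z i) /\ exists i, c i <> 0.
  apply/not_existsP => h; have := mx a.+1; rewrite ltnn => /(_ _) /negP; apply.
    apply/asboolP; exists z; split.
      by move=> i; rewrite /z; case: (unlift _ _).
    by move=> c hc i; apply: contrapT => ci; apply: (h c); split=> //; exists i.
  by [].
have c0 : c ord0 != 0.
  apply/eqP => c0; apply: ci; move: hc; rewrite zsum c0 scale0r add0r => hc.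
  by case: (unliftP ord0 i) => [j|] -> //; apply: (ix (fun j => c (lift ord0 j))).
exists (fun i => - (c ord0)^-1 * c (lift ord0 i)).
have -> : u - \sum_i (- (c ord0)^-1 * c (lift ord0 i)) *: x i =
    (c ord0)^-1 *: (\sum_i c i *: z i).
  rewrite zsum scalerDr scalerA mulVf // scale1r; congr (_ + _).
  rewrite scaler_sumr -sumrN; apply: eq_bigr => j _.
  by rewrite scalerA mulNr scaleNr opprK.
exact: subspZ.
Qed.

(** A family independent modulo W is independent modulo V, so n bounds the families of both
    quotients; both dimensions then exist, and uniqueness forces their sum to be n. *)
Lemma qdim_split V W U n : subsp V -> subsp W -> sub V W -> sub W U -> qdim V U n ->
  exists a b, [/\ qdim V W a, qdim W U b & n = (a + b)%N].
Proof.
move=> hV hW VW WU qn; have /qdimP [x [xU [ix gx]]] := qn.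
have [|a qa] := @qdim_max V W n hV.
  by move=> m y yW iy; apply: (indep_le hV) iy => j; apply/gx/WU.
have [|b qb] := @qdim_max W U n hW.
  move=> m y yU iy; have := @indep_le V n m x y hV; apply.
    by move=> j; apply: gx.
  by move=> c /VW; apply: iy.
by exists a, b; split=> //; apply: (qdim_uniq hV qn); apply: qdim_trans qa qb.
Qed.

(** Second isomorphism theorem. Backwards, a basis of (U + W)/W is replaced by the U-components of
    its members. *)
Lemma qdim_inter_plus U W n : subsp U -> subsp W ->
  qdim (inter U W) U n <-> qdim W (plus U W) n.
Proof.
move=> hU hW; split=> /qdimP [x [xU [ix gx]]]; apply/qdimP.
  have xs (c : 'I_n -> k) : U (\sum_i c i *: x i) by apply: subsp_sum => // i; apply: subspZ.
  exists x; split; first by move=> i; apply: sub_plusl.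
  split; first by move=> c hc; apply: ix; split.
  move=> _ [u [w [hu [hw ->]]]]; have [c [_ hc]] := gx _ hu; exists c.
  by rewrite KaddE addrAC; apply: subspD.
have /choice [y hy] : forall i, exists y, U y /\ W (x i - y).
  move=> i; have [u [w [hu [hw e]]]] := xU i; exists u; split=> //.
  by rewrite e KaddE addrC addKr.
have yx (c : 'I_n -> k) : W (\sum_i c i *: x i - \sum_i c i *: y i).
  rewrite -sumrB; apply: subsp_sum => // i; rewrite -scalerBr; apply: subspZ => //.
  by case: (hy i).
exists y; split; first by move=> i; case: (hy i).
split=> [c [_ hc]|u hu].
  by apply: ix; rewrite -[X in W X](subrK (\sum_i c i *: y i)); apply: subspD.
have [c hc] := gx _ (sub_plusl hW hu); exists c; split.
  by apply: subspB => //; apply: subsp_sum => // i; apply: subspZ => //; case: (hy i).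
rewrite (_ : u - _ = (u - \sum_i c i *: x i) + (\sum_i c i *: x i - \sum_i c i *: y i)).
  exact: subspD.
by rewrite addrA subrK.
Qed.

(** Exactness of 0 -> (U ∩ C)/(W ∩ C) -> U/W -> (U + C)/(W + C) -> 0. The image of the first map is
    ((U ∩ C) + W)/W; the second isomorphism theorem identifies both steps of this chain. *)
Lemma qdim_exact W U C n : subsp W -> subsp U -> subsp C -> sub W U -> qdim W U n ->
  exists a b, [/\ qdim (inter W C) (inter U C) a, qdim (plus W C) (plus U C) b & n = (a + b)%N].
Proof.
move=> hW hU hC WU qn; have hUC := subsp_inter hU hC; have hWC := subsp_plus hW hC.
have [||||a [b [qa qb ->]]] := @qdim_split W (plus (inter U C) W) U n hW.
- exact: subsp_plus.
- exact: sub_plusr.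
- by apply: plus_sub => // x [].
- by [].
exists a, b; split=> //.
  move/(qdim_inter_plus _ hUC hW): qa; congr (qdim _ _ _).
  by apply: set_ext => x [] => [[? ?] ?|? ?]; split=> //; split=> //; apply: WU.
have eUC : inter U (plus W C) = plus (inter U C) W.
  apply: set_ext => x.
    case=> hx [w [c [hw [hc e]]]]; exists c, w; rewrite e !KaddE addrC; split=> //.
    split=> //; rewrite (_ : c = x - w); first by apply: subspB => //; apply: WU.
    by rewrite e KaddE addrC addKr.
  move=> [c [w [[hU' hc] [hw ->]]]]; split; first by apply: subspD => //; apply: WU.
  by rewrite KaddE addrC; apply: plusP.
rewrite -eUC in qb; move/(qdim_inter_plus _ hU hWC): qb; congr (qdim _ _ _).
apply: set_ext.
  apply: plus_sub; [exact: subsp_plus|exact: sub_plusl|exact: plusS].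
by apply: plusS => //; apply: sub_plusr.
Qed.

(* U1 and U2 are commensurable and [U1|U2] = z. *)
Definition relindex U1 U2 (z : int) :=
  exists W n1 n2, [/\ subsp W, sub W U1, sub W U2, qdim W U1 n1 &
    qdim W U2 n2 /\ z = n2%:Z - n1%:Z].

(** Enlarging W to the intersection removes the same dimension from both codimensions, so any common
    subspace of finite codimension computes the index. *)
Lemma relindexP U1 U2 z : subsp U1 -> subsp U2 ->
  relindex U1 U2 z <-> exists n1 n2, [/\ qdim (inter U1 U2) U1 n1,
    qdim (inter U1 U2) U2 n2 & z = n2%:Z - n1%:Z].
Proof.
move=> h1 h2; have h12 := subsp_inter h1 h2; split; last first.
  move=> [n1 [n2 [q1 q2 ->]]]; exists (inter U1 U2), n1, n2.
  by split=> // x [].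
move=> [W [n1 [n2 [hW W1 W2 q1 [q2 ->]]]]].
have [||a [b [qa qb ->]]] := qdim_split hW h12 _ _ q1; first exact: inter_sub.
  by move=> x [].
have [||a' [b' [qa' qb' ->]]] := qdim_split hW h12 _ _ q2; first exact: inter_sub.
  by move=> x [].
exists b, b'; split=> //; have := qdim_uniq hW qa qa'; lia.
Qed.

Lemma commensP U1 U2 : subsp U1 -> subsp U2 ->
  commens U1 U2 <-> exists z, relindex U1 U2 z.
Proof.
move=> h1 h2; split.
  move=> [[n1 q1] [n2 q2]]; exists (n2%:Z - n1%:Z).
  by apply/(relindexP _ h1 h2); exists n1, n2.
by move=> [z /(relindexP _ h1 h2) [n1 [n2 [q1 q2 _]]]]; split; [exists n1|exists n2].
Qed.

Lemma relindex_uniq U1 U2 z z' : subsp U1 -> subsp U2 ->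
  relindex U1 U2 z -> relindex U1 U2 z' -> z = z'.
Proof.
move=> h1 h2 /(relindexP _ h1 h2) [n1 [n2 [q1 q2 ->]]].
move=> /(relindexP _ h1 h2) [n1' [n2' [q1' q2' ->]]].
have h12 := subsp_inter h1 h2.
by rewrite (qdim_uniq h12 q1 q1') (qdim_uniq h12 q2 q2').
Qed.

Lemma relindex_qdim U1 U2 n : subsp U1 -> sub U1 U2 -> qdim U1 U2 n -> relindex U1 U2 n.
Proof.
move=> h1 h12 q; exists U1, 0, n; rewrite subr0; split=> //.
exact: qdim_refl.
Qed.

Lemma relindex_refl U : subsp U -> relindex U U 0.
Proof. by move=> hU; apply: relindex_qdim => //; apply: qdim_refl. Qed.

Lemma relindex_sym U1 U2 z : relindex U1 U2 z -> relindex U2 U1 (- z).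
Proof.
move=> [W [n1 [n2 [hW W1 W2 q1 [q2 ->]]]]].
by exists W, n2, n1; rewrite opprB.
Qed.

(** W and W' both have finite codimension in U2, hence W ∩ W' has finite codimension in each of them
    and serves as common subspace of U1 and U3; counting dim U2/(W ∩ W') through W and through W'
    gives the sum. *)
Lemma relindex_trans U1 U2 U3 z z' : subsp U2 ->
  relindex U1 U2 z -> relindex U2 U3 z' -> relindex U1 U3 (z + z').
Proof.
move=> h2 [W [n1 [n2 [hW W1 W2 q1 [q2 ->]]]]] [W' [m2 [m3 [hW' W2' W3' q2' [q3' ->]]]]].
have hX := subsp_inter hW hW'.
have [a [_ [qa _ _]]] := qdim_exact hW h2 hW' W2 q2.
rewrite (inter_absorbr W2') in qa.
have [b [_ [qb _ _]]] := qdim_exact hW' h2 hW W2' q2'.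
rewrite (inter_absorbr W2) interC in qb.
have XW : sub (inter W W') W by move=> x [].
have XW' : sub (inter W W') W' by move=> x [].
have := qdim_uniq hX (qdim_trans hW XW W2 qb q2) (qdim_trans hW' XW' W2' qa q2').
exists (inter W W'), (b + n1)%N, (a + m3)%N; split=> //.
- by move=> x /XW /W1.
- by move=> x /XW' /W3'.
- exact: qdim_trans qb q1.
- by split; [exact: qdim_trans qa q3'|lia].
Qed.

(** Additivity of the index along a subspace C and its quotient. It is what makes [odot] of two
    dimension theories a dimension theory, and what isolates the share of C in the commutator. *)
Lemma relindex_exact U1 U2 C z : subsp U1 -> subsp U2 -> subsp C -> relindex U1 U2 z ->
  exists z' z'', [/\ relindex (inter U1 C) (inter U2 C) z',
    relindex (plus U1 C) (plus U2 C) z'' & z = z' + z''].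
Proof.
move=> h1 h2 hC [W [n1 [n2 [hW W1 W2 q1 [q2 ->]]]]].
have [a1 [b1 [qa1 qb1 ->]]] := qdim_exact hW h1 hC W1 q1.
have [a2 [b2 [qa2 qb2 ->]]] := qdim_exact hW h2 hC W2 q2.
exists (a2%:Z - a1%:Z), (b2%:Z - b1%:Z); split; last by lia.
  exists (inter W C), a1, a2; split=> //; first exact: subsp_inter.
    by move=> x [/W1 ? ?]; split.
  by move=> x [/W2 ? ?]; split.
exists (plus W C), b1, b2; split=> //; first exact: subsp_plus.
  exact: plusS.
exact: plusS.
Qed.

Lemma sandwich W U X Y n : subsp W -> subsp X -> subsp Y ->
  sub W X -> sub X U -> sub W Y -> sub Y U -> qdim W U n -> exists z, relindex X Y z.
Proof.
move=> hW hX hY WX XU WY YU q.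
have [a [_ [qa _ _]]] := qdim_split hW hX WX XU q.
have [b [_ [qb _ _]]] := qdim_split hW hY WY YU q.
by exists (b%:Z - a%:Z), W, a, b.
Qed.

Lemma qdim_fin (I : finType) V U (z : I -> K k) :
  (forall i, U (z i)) -> (forall c : I -> k, V (\sum_i c i *: z i) -> forall i, c i = 0) ->
  (forall u, U u -> exists c : I -> k, V (u - \sum_i c i *: z i)) ->
  qdim V U #|I|.
Proof.
move=> zU iz gz; apply/qdimP; exists (fun i => z (enum_val i)); split=> //.
have reidx (c : I -> k) :
    \sum_i c i *: z i = \sum_(i < #|I|) c (enum_val i) *: z (enum_val i).
  by rewrite (reindex (@enum_val I I)) //=; apply: onW_bij; apply: enum_val_bij.
split=> [c hc i|u /gz [c hc]].
  have := iz (fun j => c (enum_rank j)); rewrite reidx.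
  under eq_bigr => j _ do rewrite enum_valK.
  by move=> /(_ hc (enum_val i)); rewrite enum_valK.
by exists (fun i => c (enum_val i)); rewrite -reidx.
Qed.

End RelativeDimension.

(** * Valuations and O_K-lattices *)

(** The product of the two leading coefficients is a nonzero coefficient of 1, so it sits in degree
    0. *)
Lemma lau_vanishV (F : fieldType) (a : laurent F) v :
  a v != 0 -> lau_vanish a v -> lau_vanish a^-1 (- v).
Proof.
move=> av va; have a0 : a != 0 by apply: contra av => /eqP ->.
have [w [bw wb]] := lau_valP (invr_neq0 a0).
suff -> : - v = w by [].
have := lau_lead va wb; rewrite divff // lau1E => /eqP.
have [|_] := eqVneq (v + w) 0; first by move=> h _; lia.
by rewrite eq_sym mulf_eq0 (negbTE av) (negbTE bw).
Qed.

Section Lattices.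
Variable k : fieldType.
Implicit Types (U V W C : K k -> Prop) (f g x y : K k).

(* Tl n is t2^n O_K. *)
Definition Tl (n : int) : K k -> Prop := fun x => forall i j, i < n -> x i j = 0.
(** [Sb 0 l] is the S of the overview. A general [c] is needed because multiplication shifts
    exponents of t1; the powers of t2 from [l] on are left free. *)
Definition Sb (c l : int) : K k -> Prop := fun x => forall i j, i < l -> j < c -> x i j = 0.

Lemma TlP n x : Tl n x <-> lau_vanish (rows x) n.
Proof.
split=> h i; first by move=> hi; apply: laurentP => j; apply: h.
by move=> j /h e; rewrite -(row_coef x) -[row x i]/(rows x i) e.
Qed.

Lemma Tl_row n x i : Tl n x -> i < n -> row x i = 0.
Proof. by move=> /TlP h /h. Qed.

Lemma subsp_Tl n : subsp (Tl n).
Proof.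
split=> //; split=> [x y hx hy|c x hx] i j hi; first by rewrite /= hx ?hy ?addr0.
by rewrite /= hx ?mulr0.
Qed.

Lemma subsp_Sb c l : subsp (Sb c l).
Proof.
split=> //; split=> [x y hx hy|d x hx] i j hi hj; first by rewrite /= hx ?hy ?addr0.
by rewrite /= hx ?mulr0.
Qed.

Lemma Tl_mono m n : n <= m -> sub (Tl m) (Tl n).
Proof. by move=> h x hx i j hi; apply: hx; apply: lt_le_trans hi h. Qed.

Lemma Sb_mono c l c' l' : c' <= c -> l' <= l -> sub (Sb c l) (Sb c' l').
Proof. by move=> h h' x hx i j hi hj; apply: hx; [apply: lt_le_trans hi h'|apply: lt_le_trans hj h]. Qed.

Lemma Tl_Sb c l : sub (Tl l) (Sb c l).
Proof. by move=> x hx i j hi _; apply: hx. Qed.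

Lemma rowsM' x y : rows (x * y) = rows x * rows y.
Proof. exact: rowsM. Qed.

Lemma Tl_mul m n x y : Tl m x -> Tl n y -> Tl (m + n) (x * y).
Proof. by move=> /TlP hx /TlP hy; apply/TlP; rewrite rowsM'; apply: lau_vanishM. Qed.

Lemma row_lead m n x y : Tl m x -> Tl n y -> row (x * y) (m + n) = row x m * row y n.
Proof.
move=> /TlP hx /TlP hy; rewrite -[LHS]/(rows (x * y) (m + n)) rowsM'.
exact: lau_lead.
Qed.

Lemma nu2P x : x != 0 -> row x (nu2 x) != 0 /\ Tl (nu2 x) x.
Proof.
move=> x0; have : rows x != 0 by apply: contra x0 => /eqP e; apply/eqP/rows_inj; rewrite e rows0.
move=> /lau_valP [v [av /TlP va]]; have ex : exists i, is_nu2 x i.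
  exists v; split; last by move=> i hi j; apply: va.
  apply: contrapT => h; case/negP: av; apply/eqP/laurentP => j.
  by apply: contrapT => hj; apply: h; exists j.
have [[j hj] h2] := epsilon_spec (inhabits 0) _ ex; split.
  by apply/eqP => e; apply: hj; rewrite -/(nu2 x) -(row_coef x) e.
by move=> i j' hi; apply: h2.
Qed.

Lemma nu1P x : x != 0 -> row x (nu2 x) (nu1 x) != 0 /\ lau_vanish (row x (nu2 x)) (nu1 x).
Proof.
move=> /nu2P [/lau_valP [v [av va]] _]; have ex : exists i, is_nu1 x i.
  by exists v; split; [apply/eqP|exact: va].
by have [h1 h2] := epsilon_spec (inhabits 0) _ ex; split; [apply/eqP|].
Qed.

Lemma row1 i : row (1 : K k) i = (i == 0)%:R.
Proof.
transitivity (rows (1 : K k) i) => //; rewrite (of_rowsK (1 : laurent (laurent k))).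
exact: lau1E.
Qed.

Lemma TlV x : x != 0 -> Tl (- nu2 x) x^-1 /\ row x^-1 (- nu2 x) = (row x (nu2 x))^-1.
Proof.
move=> x0; have [rx tx] := nu2P x0; have [ry ty] := nu2P (invr_neq0 x0).
have := row_lead tx ty; rewrite divff // row1.
have [h|_] := eqVneq (nu2 x + nu2 x^-1) 0; last first.
  by move/eqP; rewrite eq_sym mulf_eq0 (negbTE rx) (negbTE ry).
have -> : - nu2 x = nu2 x^-1 by lia.
move=> e; split=> //; apply: (mulfI rx); rewrite -e divff //.
Qed.

(* a t2^i *)
Definition row_K (i : int) (a : laurent k) : K k :=
  of_rows (Laurent (F := laurent k) (lcoef := fun p => if p == i then a else 0)
    (ex_intro _ i (fun p hp => ifF _ _ (lt_eqF hp)))).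

Lemma row_row_K i a p : row (row_K i a) p = if p == i then a else 0.
Proof. by apply: laurentP => j; rewrite /= ; case: eqP. Qed.

Lemma row_K_coef i a p j : row_K i a p j = if p == i then a j else 0.
Proof. by rewrite /=; case: eqP. Qed.

Lemma row_row_KM i a x p : row (row_K i a * x) p = a * row x (p - i).
Proof.
rewrite (@rowM _ _ _ _ [:: i]) // ?big_seq1 ?row_row_K ?eqxx // => q.
by apply: contraNT; rewrite inE => /negbTE e; rewrite row_row_K e mul0r.
Qed.

Lemma row_KM i i' (a b : laurent k) : row_K i a * row_K i' b = row_K (i + i') (a * b).
Proof.
apply: rows_inj; apply: laurentP => p; rewrite -[LHS]/(row _ p) -[RHS]/(row _ p).
rewrite row_row_KM !row_row_K.
have -> : (p - i == i') = (p == i + i') by lia.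
by case: eqP => _; rewrite ?mulr0.
Qed.

Fact lbdd_lmono (j : int) : lbdd (fun q => (q == j)%:R : k).
Proof. by exists j => q hq; rewrite lt_eqF. Qed.
(* t2^i t1^j *)
Definition mono (i j : int) : K k := row_K i (Laurent (lbdd_lmono j)).

Lemma monoE i j p q : mono i j p q = ((p == i) && (q == j))%:R.
Proof. by rewrite row_K_coef; case: eqP. Qed.

Lemma mono_neq0 i j : mono i j != 0.
Proof.
apply/eqP => /(congr1 (fun x : K k => x i j)); rewrite monoE !eqxx => /eqP.
by rewrite oner_eq0.
Qed.

Lemma Tl_sub_le m n : sub (Tl m) (Tl n : K k -> Prop) -> n <= m.
Proof.
move=> h; rewrite leNgt; apply/negP => lt.
have /h : Tl m (mono m 0) by move=> i j hi; rewrite monoE lt_eqF.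
by move=> /(_ m 0 lt); rewrite monoE !eqxx => /eqP; rewrite oner_eq0.
Qed.

Lemma lattice_Tl n : lattice (Tl n).
Proof.
have [_ [hD _]] := subsp_Tl n.
split; first split=> //; first split=> // a x ha hx.
  by have := Tl_mul ha hx; rewrite add0r.
have mT i j : Tl i (mono i j) by move=> p q hp; rewrite monoE lt_eqF.
split; first by exists (mono n 0); split; [exact: mT|apply/eqP/mono_neq0].
split.
  exists (mono (n - 1) 0) => /(_ (n - 1) 0); rewrite monoE !eqxx => h.
  by have /eqP := h ltac:(lia); rewrite oner_eq0.
move=> y; exists (y / mono n 0), (mono n 0); split; first exact: mT.
by rewrite KmulE divfK ?mono_neq0.
Qed.

(** An element z of L brings with it everything of t2-valuation at least [nu2 z]. Hence a vector
    outside L bounds the valuations in L from below, and an element of least valuation generates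
    L. *)
Lemma lattice_is_Tl L : lattice L -> exists n, L = Tl n.
Proof.
move=> [[L0 [LD LM]] [[x [Lx /eqP x0]] [[y Ly] _]]].
have up z w : L z -> z != 0 -> Tl (nu2 z) w -> L w.
  move=> Lz z0 tw; rewrite -[w](divfK z0); apply: LM => //.
  by have := Tl_mul tw (TlV z0).1; rewrite subrr.
have y0 : y != 0 by apply: contra_notN Ly => /eqP ->.
have lt_nu z : L z -> z != 0 -> nu2 y < nu2 z.
  move=> Lz z0; rewrite ltNge; apply: contra_notN Ly => le.
  by apply: (up z) => //; apply: Tl_mono le _ _; apply: (nu2P y0).2.
pose P (n : nat) := `[< exists z, [/\ L z, z != 0 & nu2 z = nu2 y + n%:Z] >].
have exP : exists n, P n.
  exists (absz (nu2 x - nu2 y)); apply/asboolP; exists x; split=> //.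
  by have := lt_nu _ Lx x0; lia.
case: (ex_minnP exP) => n /asboolP [z [Lz z0 ez]] mn; exists (nu2 z).
apply: set_ext => w; last exact: up.
move=> Lw; have [->|w0] := eqVneq w 0; first exact: subsp0 (subsp_Tl _).
apply: Tl_mono (nu2P w0).2; rewrite ez.
have := lt_nu _ Lw w0; have := mn (absz (nu2 w - nu2 y)) => h lt.
have : P `|nu2 w - nu2 y|%N by apply/asboolP; exists w; split=> //; lia.
by move/h; lia.
Qed.

(** Row i of the product involves rows of f up to i - n and rows of x up to i - m only; the two
    bounds on e keep these where the t1-exponents are controlled. *)
Lemma Sb_mul m n a c p q e f x : Tl m f -> Tl n x -> Sb a p f -> Sb c q x ->
  e <= p + n -> e <= q + m -> Sb (a + c) e (f * x).
Proof.
move=> tf tx sf sx h1 h2 i j hi; move: j; rewrite -/(lau_vanish (row (f * x) i) (a + c)).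
have van0 : lau_vanish (0 : laurent k) (a + c) by [].
rewrite (@rowM _ _ _ _ (zrange m (i - n))) ?zrange_uniq //; last first.
  move=> u; apply: contraNT; rewrite mem_zrange negb_and => /orP[h|h].
    by rewrite (Tl_row tf) ?mul0r //; lia.
  by rewrite (Tl_row tx) ?mulr0 //; lia.
move=> j hj; rewrite lau_sumE big_seq big1 // => u; rewrite mem_zrange => hu.
apply: lau_vanishM hj => v hv; first by apply: sf => //; lia.
by apply: sx => //; lia.
Qed.

(** Only finitely many rows lie between m and l, and each is bounded below in t1; the induction is
    on their number. *)
Lemma Tl_Sb_ex m l x : Tl m x -> exists N, Sb N l x.
Proof.
move=> tx; suff [N hN] : exists N, Sb N (m + `|l - m|%N%:Z) x.
  by exists N; apply: Sb_mono hN => //; lia.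
elim: `|l - m|%N => [|d [N hN]]; first by exists 0; rewrite addr0; apply: Tl_Sb.
have [M hM] := lcoefP (row x (m + d%:Z)).
exists (Num.min N M) => i j hi; rewrite lt_min => /andP[jN jM].
have [h|h] := ltP i (m + d%:Z); first exact: hN.
have -> : i = m + d%:Z by lia.
exact: hM.
Qed.

Lemma Sb_common (I : finType) (m l : int) (x : I -> K k) :
  (forall i, Tl m (x i)) -> exists N : nat, forall i, Sb (- N%:Z) l (x i).
Proof.
move=> tx; have /choice [M hM] : forall i, exists N, Sb N l (x i).
  by move=> i; apply: Tl_Sb_ex (tx i).
exists (\sum_i `|M i|)%N => i; apply: Sb_mono (hM i) => //.
by rewrite (bigD1 i) //=; lia.
Qed.

Fact isK_trunc n x : isK (fun i j => if i < n then x i j else 0).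
Proof.
have [[N hN] h2] := kcP x; split.
  by exists N => i hi j; case: ifP => // _; apply: hN.
move=> i; have [M hM] := h2 i; exists M => j hj; case: ifP => // _; exact: hM.
Qed.
Definition trunc n x : K k := MkK (isK_trunc n x).

Lemma trunc_rest n x : Tl n (x - trunc n x).
Proof. by move=> i j hi; rewrite KDE KNE /= hi subrr. Qed.
Lemma Tl_trunc m n x : Tl m x -> Tl m (trunc n x).
Proof. by move=> h i j hi /=; case: ifP => // _; apply: h. Qed.
Lemma Sb_trunc c l n x : Sb c n x -> Sb c l (trunc n x).
Proof. by move=> h i j hi hj /=; case: ifP => // hn; apply: h. Qed.

End Lattices.

(** * Images under multiplication; boxes *)

Section Images.
Variable k : fieldType.
Implicit Types (U V W C : K k -> Prop) (f g x y : K k).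

Lemma image_in f U x : U x -> image f U (f * x).
Proof. by move=> hx; exists x. Qed.

Lemma imageS f U V : sub U V -> sub (image f U) (image f V).
Proof. by move=> h _ [x [/h hx ->]]; exists x. Qed.

Lemma image_comp f g U : image f (image g U) = image (f * g) U.
Proof.
apply: set_ext => x.
  by move=> [_ [[y [hy ->]] ->]]; rewrite !KmulE mulrA; apply: image_in.
by move=> [y [hy ->]]; rewrite KmulE -mulrA; apply/image_in/image_in.
Qed.

Lemma image1 U : image 1 U = U.
Proof.
apply: set_ext => x; first by move=> [y [hy ->]]; rewrite KmulE mul1r.
by move=> hx; exists x; rewrite KmulE mul1r.
Qed.

Lemma imageK f U : f != 0 -> image f^-1 (image f U) = U.
Proof. by move=> f0; rewrite image_comp mulVf // image1. Qed.
Lemma imageVK f U : f != 0 -> image f (image f^-1 U) = U.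
Proof. by move=> f0; rewrite image_comp mulfV // image1. Qed.

Lemma image_swap f g U : image f (image g U) = image g (image f U).
Proof. by rewrite !image_comp mulrC. Qed.

Lemma preimE f U : f != 0 -> preim f U = image f^-1 U.
Proof.
move=> f0; apply: set_ext => x; rewrite /preim KmulE.
  by move=> hx; exists (f * x); rewrite KmulE mulKf.
by move=> [y [hy ->]]; rewrite KmulE mulVKf.
Qed.

Lemma image_sub f U V : f != 0 -> sub (image f U) V <-> sub U (image f^-1 V).
Proof.
move=> f0; split=> h.
  by rewrite -(@imageK f U) //; apply: imageS.
by rewrite -(@imageVK f V) //; apply: imageS.
Qed.

Lemma subsp_image f U : subsp U -> subsp (image f U).
Proof.
move=> hU; split; first by exists 0; split; [apply: subsp0|rewrite KmulE mulr0].
split=> [_ _ [x [hx ->]] [y [hy ->]]|c _ [x [hx ->]]].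
  by rewrite KaddE !KmulE -mulrDr; apply: image_in; apply: subspD.
rewrite KscaleE KmulE mulrC KscalerAl mulrC; apply: image_in; exact: subspZ.
Qed.

Lemma image_inter f U V : f != 0 -> image f (inter U V) = inter (image f U) (image f V).
Proof.
move=> f0; apply: set_ext => x.
  by move=> [y [[hu hv] ->]]; split; apply: image_in.
move=> [[y [hy ->]] [z [hz /(mulfI f0) e]]].
by apply: image_in; split=> //; rewrite e.
Qed.

Lemma image_plus f U V : image f (plus U V) = plus (image f U) (image f V).
Proof.
apply: set_ext => x.
  move=> [_ [[u [v [hu [hv ->]]]] ->]]; rewrite KmulE KaddE mulrDr.
  by apply: plusP; apply: image_in.
move=> [_ [_ [[u [hu ->]] [[v [hv ->]] ->]]]]; exists (u + v); split; first exact: plusP.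
by rewrite KaddE !KmulE mulrDr.
Qed.

Lemma qdim_image f U V n : f != 0 -> qdim V U n -> qdim (image f V) (image f U) n.
Proof.
move=> f0 /qdimP [x [xU [ix gx]]]; apply/qdimP.
have fs (c : 'I_n -> k) : \sum_i c i *: (f * x i) = f * \sum_i c i *: x i.
  by rewrite mulr_sumr; apply: eq_bigr => i _; rewrite mulrC KscalerAl mulrC.
exists (fun i => f * x i); split; first by move=> i; apply: image_in.
split=> [c|_ [u [/gx [c hc] ->]]].
  by rewrite fs => -[y [hy /(mulfI f0) e]]; apply: ix; rewrite e.
by exists c; rewrite fs KmulE -mulrBr; apply: image_in.
Qed.

Lemma relindex_image f U V z : f != 0 -> relindex U V z ->
  relindex (image f U) (image f V) z.
Proof.
move=> f0 [W [n1 [n2 [hW W1 W2 q1 [q2 ->]]]]]; exists (image f W), n1, n2; split.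
- exact: subsp_image.
- exact: imageS.
- exact: imageS.
- exact: qdim_image.
- by split=> //; apply: qdim_image.
Qed.

Lemma image_Tl f n : f != 0 -> image f (Tl n) = Tl (n + nu2 f).
Proof.
move=> f0; apply: set_ext.
  by move=> _ [x [hx ->]]; rewrite addrC; apply: Tl_mul hx; apply: (nu2P f0).2.
rewrite -{1}(@imageVK f (Tl (n + _))) //; apply: imageS => _ [y [hy ->]].
by have := Tl_mul (TlV f0).1 hy; rewrite addrC addrK.
Qed.

Lemma nu2V f : f != 0 -> nu2 f^-1 = - nu2 f.
Proof.
move=> f0; have h (m n : int) : Tl m = Tl n :> (K k -> Prop) -> n <= m.
  by move=> emn; apply: (@Tl_sub_le k); rewrite emn.
have := image_Tl 0 (invr_neq0 f0); have := image_Tl (- nu2 f) f0.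
rewrite addNr => <-; rewrite imageK // add0r => e.
by apply/le_anti/andP; split; apply: h.
Qed.

End Images.

Section Boxes.
Variable k : fieldType.
Implicit Types (U V W C : K k -> Prop) (f g x y : K k).

(* The k[[t1]]-lattice t1^c (t2^n O_K / t2^l O_K), pulled back to K. *)
Definition Qb (c n l : int) : K k -> Prop := inter (Tl n) (Sb c l).

Lemma subsp_Qb c n l : subsp (Qb c n l).
Proof. by apply: subsp_inter; [apply: subsp_Tl|apply: subsp_Sb]. Qed.

Lemma Qb_mono c c' n l : c <= c' -> sub (Qb c' n l) (Qb c n l).
Proof. by move=> h x [h1 h2]; split=> //; apply: Sb_mono h2. Qed.

Lemma Tl_Qb c n l : n <= l -> sub (Tl l) (Qb c n l).
Proof. by move=> h x hx; split; [apply: Tl_mono hx|apply: Tl_Sb]. Qed.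

(** The monomials t2^(n+s) t1^(a+u) with s < r and u < d form a basis of the quotient. *)
Lemma qdim_Qb (a n : int) (r d : nat) :
  qdim (Qb (a + d%:Z) n (n + r%:Z)) (Qb a n (n + r%:Z)) (r * d)%N.
Proof.
pose z (s : 'I_r * 'I_d) : K k := mono k (n + s.1%:Z) (a + s.2%:Z).
have zc (c : 'I_r * 'I_d -> k) (s0 : 'I_r * 'I_d) :
    (\sum_s c s *: z s) (n + s0.1%:Z) (a + s0.2%:Z) = c s0.
  rewrite K_sumE (bigD1 s0) // big1 => [|s ne].
    by rewrite KZE monoE !eqxx mulr1; apply: addr0.
  rewrite KZE monoE; case: andP => [[/eqP e1 /eqP e2]|_]; last by rewrite mulr0.
  case/eqP: ne; apply/eqP; rewrite -pair_eqE /=; apply/andP.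
  by split; apply/eqP/val_inj => /=; lia.
have zQ s : Qb a n (n + r%:Z) (z s).
  split=> i j hi; rewrite monoE; first by rewrite (_ : _ == _ = false) //; lia.
  by move=> hj; rewrite (_ : (j == _) = false) ?andbF //; lia.
rewrite -[r]card_ord -[d in X in qdim _ _ X]card_ord -card_prod card_ord.
apply: (qdim_fin (z := z)) => // [c [_ hc] s|u hu].
  by rewrite -zc; apply: hc; rewrite ltrD2l ltz_nat ltn_ord.
pose c (s : 'I_r * 'I_d) := u (n + s.1%:Z) (a + s.2%:Z).
have [hQ1 hQ2] : Qb a n (n + r%:Z) (u - \sum_i c i *: z i).
  apply: subspB => //; first exact: subsp_Qb.
  apply: subsp_sum; first exact: subsp_Qb.
  by move=> s; apply: subspZ => //; apply: subsp_Qb.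
exists c; split=> // i j hi hj.
have [lin|nin] := ltP i n; first exact: hQ1.
have [laj|naj] := ltP j a; first exact: hQ2.
have hr : (`|i - n| < r)%N by lia.
have hd : (`|j - a| < d)%N by lia.
have [s [-> ->]] : exists s : 'I_r * 'I_d, i = n + s.1%:Z /\ j = a + s.2%:Z.
  by exists (Ordinal hr, Ordinal hd); split=> /=; lia.
by rewrite KDE KNE zc subrr.
Qed.

Lemma sandwich_Qb (N M n l : int) X Y : N <= M -> n <= l -> subsp X -> subsp Y ->
  sub (Qb M n l) X -> sub X (Qb N n l) -> sub (Qb M n l) Y -> sub Y (Qb N n l) ->
  exists z, relindex X Y z.
Proof.
move=> NM nl hX hY h1 h2 h3 h4; have := qdim_Qb N n `|l - n| `|M - N|.
have -> : N + `|M - N|%N = M by lia.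
have -> : n + `|l - n|%N = l by lia.
by move=> q; apply: (sandwich (subsp_Qb M n l) hX hY h1 h2 h3 h4 q).
Qed.

Lemma QbI_Tl c n m l : n <= m -> inter (Qb c n l) (Tl m) = Qb c m l.
Proof.
move=> nm; apply: set_ext => [x [[_ h] h']|x [h1 h2]]; first by split.
by split=> //; split=> //; apply: Tl_mono h1.
Qed.

Lemma QbD_Tl c n m l : n <= m -> m <= l -> plus (Qb c n l) (Tl m) = Qb c n m.
Proof.
move=> nm ml; apply: set_ext.
  apply: plus_sub; first exact: subsp_Qb.
    by move=> x [h1 h2]; split=> //; apply: Sb_mono h2.
  exact: Tl_Qb.
move=> x [h1 h2]; rewrite -[x](subrK (trunc m x)) addrC; apply: plusP.
  by split; [apply: Tl_trunc|apply: Sb_trunc].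
exact: trunc_rest.
Qed.

(** The loss N is uniform in c: it bounds the t1-exponents of those rows of f that can reach below
    t2^(l + nu2 f). *)
Lemma image_Qb_sub f n l : f != 0 -> exists N : nat, forall c,
  sub (image f (Qb c n l)) (Qb (c - N%:Z) (n + nu2 f) (l + nu2 f)).
Proof.
move=> f0; have [_ tf] := nu2P f0; have [N hN] := @Tl_Sb_ex _ _ (l + nu2 f - n) _ tf.
exists `|N|%N => c _ [x [[h1 h2] ->]]; split.
  by rewrite addrC; apply: Tl_mul.
apply: Sb_mono (@Sb_mul _ _ _ N c (l + nu2 f - n) l (l + nu2 f) _ _ tf h1 hN h2 _ _) => //; lia.
Qed.

(** On a single graded piece of the t2-filtration, multiplication by f is multiplication by its row
    m alone. *)
Lemma image_Qb_row f m v c n : Tl m f -> lau_vanish (row f m) v ->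
  sub (image f (Qb c n (n + 1))) (Qb (v + c) (n + m) (n + m + 1)).
Proof.
move=> tf vf _ [x [[h1 h2] ->]]; have tfx := Tl_mul tf h1; split.
  by rewrite [n + m]addrC.
move=> i j hi hj; have [h|h] := ltP i (m + n); first exact: tfx.
have -> : i = m + n by lia.
rewrite -row_coef (row_lead tf h1); apply: lau_vanishM hj => //.
by move=> q hq; apply: h2 => //; lia.
Qed.

Lemma image_Qb_row_eq f n : f != 0 ->
  image f (Qb 0 n (n + 1)) = Qb (nu1 f) (n + nu2 f) (n + nu2 f + 1).
Proof.
move=> f0; have [_ tf] := nu2P f0; have [vf0 vf] := nu1P f0.
have [tg rg] := TlV f0.
apply: set_ext; first by have := @image_Qb_row f (nu2 f) (nu1 f) 0 n tf vf; rewrite addr0.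
rewrite -{1}(@imageVK _ f (Qb _ (n + _) _)) //; apply: imageS.
have := @image_Qb_row f^-1 (- nu2 f) (- nu1 f) (nu1 f) (n + nu2 f) tg.
by rewrite addNr addrK; apply; rewrite rg; apply: lau_vanishV.
Qed.

Lemma relindex_Qb_row v n : relindex (Qb v n (n + 1)) (Qb 0 n (n + 1)) v.
Proof.
have [h|h] := leP 0 v.
  have := qdim_Qb 0 n 1 `|v|; rewrite mul1n add0r gez0_abs //.
  move=> q; have := relindex_qdim (subsp_Qb _ _ _) (Qb_mono h) q.
  by rewrite gez0_abs.
have := qdim_Qb v n 1 `|v|; rewrite mul1n ltz0_abs // subrr.
move=> q; have := relindex_qdim (subsp_Qb _ _ _) (Qb_mono (ltW h)) q.
by move/relindex_sym; rewrite ltz0_abs // opprK.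
Qed.

End Boxes.

(** * Lattices over k[[t1]] *)

Section T1Lattices.
Variable k : fieldType.
Implicit Types (U V W C A B : K k -> Prop) (f g x y : K k).

(** The image lies in a large box by the estimate for f, and contains a small one by the same
    estimate for f^-1. *)
Lemma relindex_image_Qb_ex f n l : f != 0 -> n <= l ->
  exists z, relindex (image f (Qb 0 n l)) (Qb 0 (n + nu2 f) (l + nu2 f)) z.
Proof.
move=> f0 nl; have [N hN] := image_Qb_sub n l f0.
have [M hM] := image_Qb_sub (n + nu2 f) (l + nu2 f) (invr_neq0 f0).
have sQ := @subsp_Qb k.
apply: (@sandwich_Qb k (- N%:Z) M%:Z (n + nu2 f) (l + nu2 f)) => //; try lia.
- exact: subsp_image.
- have := hM M%:Z; rewrite nu2V // subrr !addrK image_sub ?invr_neq0 //.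
  by rewrite invrK.
- by have := hN 0; rewrite sub0r.
- by apply: Qb_mono; lia.
- by apply: Qb_mono; lia.
Qed.

(** Induction on the number of rows, splitting off the lowest one: the remaining rows form a
    subspace stable up to the shift by nu2 f, and the quotient row is moved by the leading row of f
    only. *)
Lemma relindex_image_Qb f n l : f != 0 -> n <= l ->
  relindex (image f (Qb 0 n l)) (Qb 0 (n + nu2 f) (l + nu2 f)) (nu1 f * (l - n)).
Proof.
move=> f0 nl; have [d ->] : exists d : nat, n = l - d%:Z by exists `|l - n|%N; lia.
clear n nl; have sQ := @subsp_Qb k; have sI := fun c n l => subsp_image f (sQ c n l).
elim: d => [|d IH].
  (* With no rows left the box is the whole lattice t2^l O_K, which f maps exactly onto t2^(l + nu2
     f) O_K. *)
  have Qll c m : Qb c m m = Tl m :> (K k -> Prop).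
    by apply: set_ext => [x []//|x hx]; apply: Tl_Qb.
  by rewrite subr0 subrr mulr0 !Qll image_Tl //; apply: relindex_refl; apply: subsp_Tl.
set n := l - d%:Z in IH *; have -> : l - d.+1%:Z = n - 1 by rewrite /n; lia.
have nl : n <= l by rewrite /n; lia.
have [|z rz] := @relindex_image_Qb_ex f (n - 1) l f0; first by lia.
(* Cutting at t2^(n + nu2 f) leaves the rows from n on in the intersections, handled by [IH], and
   the single row n - 1 in the quotients. *)
have [z1 [z2 [r1 r2 ez]]] := relindex_exact (sI _ _ _) (sQ _ _ _) (subsp_Tl k (n + nu2 f)) rz.
rewrite -{1}(image_Tl _ f0) -image_inter // !QbI_Tl in r1; try lia.
rewrite -{1}(image_Tl _ f0) -image_plus !QbD_Tl in r2; try lia.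
rewrite (relindex_uniq (sI _ _ _) (sQ _ _ _) r1 IH) in ez.
have := image_Qb_row_eq (n - 1) f0; rewrite subrK => e.
rewrite e (_ : n + nu2 f = n - 1 + nu2 f + 1) in r2; last by lia.
rewrite (relindex_uniq (sQ _ _ _) (sQ _ _ _) r2 (relindex_Qb_row k (nu1 f) (n - 1 + nu2 f))) in ez.
suff -> : nu1 f * (l - (n - 1)) = z by [].
by rewrite ez; ring.
Qed.

Lemma isKbarP x : isKbar x <-> x = row_K 0 (row x 0).
Proof.
split=> [h|->]; last first.
  by move=> i j hi; rewrite row_K_coef (negbTE hi).
apply: Kext => i j; rewrite row_K_coef; case: eqP => [->//|/eqP hi]; exact: h.
Qed.

Lemma isOt1P x : isOt1 x <-> isKbar x /\ Sb 0 1 x.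
Proof.
split=> [h|[h1 h2] i j].
  by split=> [i j hi|i j _ hj]; apply: h; rewrite ?hi ?hj ?orbT.
have [->/=|hi _] := eqVneq i 0; last exact: h1.
exact: h2.
Qed.

Lemma Tl_Kbar x : isKbar x -> Tl 0 x.
Proof. by move=> h i j hi; apply: h; rewrite lt_eqF. Qed.

Lemma Sb_Kbar c l x : isKbar x -> Sb c 1 x -> Sb c l x.
Proof.
move=> h hx i j _ hj; have [->|hi] := eqVneq i 0; [exact: hx|exact: h].
Qed.

Lemma isKbar_mul x y : isKbar x -> isKbar y -> isKbar (x * y).
Proof. by move=> /isKbarP -> /isKbarP ->; rewrite row_KM addr0 => i j hi; rewrite row_K_coef (negbTE hi). Qed.

Lemma isKbar_row_K a : isKbar (row_K 0 a : K k).
Proof. by move=> i j hi; rewrite row_K_coef (negbTE hi). Qed.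

Lemma isKbar_sum (I : Type) (r : seq I) (G : I -> K k) :
  (forall i, isKbar (G i)) -> isKbar (\sum_(i <- r) G i).
Proof.
move=> hG i j hi; rewrite K_sumE big1 // => t _; exact: hG.
Qed.

Lemma Tl_decomp m (d : nat) x : Tl m x ->
  Tl (m + d%:Z) (x - \sum_(s < d) row_K 0 (row x (m + s%:Z)) * mono k (m + s%:Z) 0).
Proof.
move=> tx i j hi; have coef (s : 'I_d) :
  (row_K 0 (row x (m + s%:Z)) * mono k (m + s%:Z) 0) i j =
    if i == m + s%:Z then x (m + s%:Z) j else 0.
  rewrite row_KM add0r row_K_coef; case: eqP => // _.
  rewrite (_ : Laurent _ = 1) ?mulr1 //; exact: laurentP.
rewrite KDE KNE K_sumE (eq_bigr _ (fun s _ => coef s)).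
have [lt|le] := ltP i m.
  rewrite tx // big1 ?subr0 // => s _; case: eqP => // e; lia.
have hd : (`|i - m| < d)%N by lia.
rewrite (bigD1 (Ordinal hd)) //= big1 => [|s /eqP ne].
  have -> : m + `|i - m|%N = i by lia.
  by rewrite eqxx; apply/eqP; rewrite subr_eq0; apply/eqP/esym/addr0.
by case: eqP => // e; case: ne; apply: val_inj => /=; lia.
Qed.

Definition box (l : int) : K k -> Prop := Sb 0 l.

(** The generators are t2^m, ..., t2^(l-1); in this basis the box is the standard
    k[[t1]]-lattice. *)
Lemma t1lattice_box (m l : int) : m <= l -> t1lattice (Tl l) (Tl m) (inter (box l) (Tl m) : K k -> Prop).
Proof.
move=> ml; pose r := `|l - m|%N; have el : m + r%:Z = l by rewrite /r; lia.
pose g (s : 'I_r) := mono k (m + s%:Z) 0.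
have gT s : Tl m (g s) by move=> i j hi; rewrite monoE (_ : _ == _ = false) //; lia.
have gS s : Sb 0 l (g s).
  by move=> i j _ hj; rewrite monoE (lt_eqF hj) andbF.
exists r, g; split=> //; split=> [x|x tx]; last first.
  exists (x - \sum_(s < r) row_K 0 (row x (m + s%:Z)) * g s), (fun s => row_K 0 (row x (m + s%:Z))).
  split; first by rewrite -el; apply: Tl_decomp.
  by split; [move=> i; apply: isKbar_row_K|rewrite KaddE /Ksum subrK].
split=> [[bx tx]|[z [a [hz [ha ->]]]]].
  exists (x - \sum_(s < r) row_K 0 (row x (m + s%:Z)) * g s), (fun s => row_K 0 (row x (m + s%:Z))).
  split; first by rewrite -el; apply: Tl_decomp.
  split; last by rewrite KaddE /Ksum subrK.
  move=> s; apply/isOt1P; split; first exact: isKbar_row_K.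
  move=> i j hi hj; rewrite row_K_coef; case: eqP => // _; apply: bx => //.
  by have := ltn_ord s; lia.
rewrite KaddE; split.
  apply: (subspD (subsp_Sb k 0 l)); first exact: Tl_Sb.
  apply: subsp_sum; first exact: subsp_Sb.
  move=> s; have /isOt1P [ka sa] := ha s.
  by have := Sb_mul (Tl_Kbar ka) (gT s) (Sb_Kbar (l := l - m) ka sa) (gS s) (e := l); rewrite addr0 subrK; apply.
apply: (subspD (subsp_Tl k m)); first exact: Tl_mono hz.
apply: subsp_sum; first exact: subsp_Tl.
move=> s; have /isOt1P [ka sa] := ha s.
by rewrite KmulE -[m]add0r; apply: Tl_mul => //; apply: Tl_Kbar.
Qed.

(** The generators have t1-exponents bounded below in the rows that matter, which gives the outer
    box. Conversely the powers of t2 are Kbar-combinations of the generators modulo t2^l, and a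
    power of t1 clears the finitely many denominators, which gives the inner box. *)
Lemma t1lattice_sandwich (m l : int) Lam : m <= l -> t1lattice (Tl l) (Tl m) Lam ->
  exists N : nat, sub (Qb N%:Z m l) Lam /\ sub Lam (Qb (- N%:Z) m l : K k -> Prop).
Proof.
move=> ml [r [g [gT [LamP span]]]].
have [N1 hN1] := Sb_common l gT.
pose d := `|l - m|%N; have el : m + d%:Z = l by rewrite /d; lia.
have mT (s : 'I_d) : Tl m (mono k (m + s%:Z) 0).
  by move=> i j hi; rewrite monoE (_ : _ == _ = false) //; lia.
have /choice [z hz] : forall s : 'I_d, exists z, Tl l z /\ exists b : 'I_r -> K k,
    (forall i, isKbar (b i)) /\ mono k (m + s%:Z) 0 = z + \sum_i b i * g i.
  by move=> s; have [z [b [h1 h2]]] := span _ (mT s); exists z; split=> //; exists b.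
have /choice [b hb] := fun s => (hz s).2.
have [N2 hN2] := @Sb_common k _ 0 1 (fun p : 'I_d * 'I_r => b p.1 p.2)
  (fun p => Tl_Kbar ((hb p.1).1 p.2)).
exists (maxn N1 N2); split.
  move=> x [tx sx]; apply/LamP.
  pose xi (s : 'I_d) := row_K 0 (row x (m + s%:Z)).
  have kxi s : isKbar (xi s) by apply: isKbar_row_K.
  have sxi s : Sb N2%:Z 1 (xi s).
    move=> i j hi hj; rewrite row_K_coef; case: eqP => // _; apply: sx; last by lia.
    by have := ltn_ord s; lia.
  pose w := x - \sum_(s < d) xi s * mono k (m + s%:Z) 0.
  have hw : Tl l w by rewrite -el; apply: Tl_decomp.
  (* Substitution of the expansions of the monomials t2^(m+s) into that of x; the parts in t2^l O_K
     are collected in the first component. *)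
  exists (w + \sum_s xi s * z s), (fun i => \sum_s xi s * b s i); split.
    apply: (subspD (subsp_Tl k l)) => //.
    apply: subsp_sum; first exact: subsp_Tl.
    move=> s; rewrite -[l]add0r; apply: Tl_mul; first exact: Tl_Kbar.
    by case: (hz s).
  split.
    move=> i; apply/isOt1P; split.
      by apply: isKbar_sum => s; apply: isKbar_mul => //; case: (hb s).
    apply: subsp_sum; first exact: subsp_Sb.
    move=> s; have kb : isKbar (b s i) by case: (hb s).
    have := Sb_mul (Tl_Kbar (kxi s)) (Tl_Kbar kb) (sxi s) (hN2 (s, i)) (e := 1).
    by rewrite subrr; apply; rewrite addr0.
  rewrite KaddE -[Ksum _]/(\sum_i (\sum_s xi s * b s i) * g i).
  under [X in _ + X]eq_bigr => i _ do rewrite mulr_suml.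
  rewrite exchange_big /= -addrA -big_split /= -[LHS](subrK (\sum_(s < d) xi s * mono k (m + s%:Z) 0)).
  congr (_ + _); apply: eq_bigr => s _; rewrite {1}(hb s).2 mulrDr; congr (_ + _).
  by rewrite mulr_sumr; apply: eq_bigr => i _; rewrite mulrA.
move=> x /LamP [y [a [hy [ha ->]]]]; rewrite KaddE; split.
  apply: (subspD (subsp_Tl k m)); first exact: Tl_mono hy.
  apply: subsp_sum; first exact: subsp_Tl.
  move=> s; have /isOt1P [ka sa] := ha s.
  by rewrite KmulE -[m]add0r; apply: Tl_mul => //; apply: Tl_Kbar.
apply: (subspD (subsp_Sb k _ l)); first exact: Tl_Sb.
apply: subsp_sum; first exact: subsp_Sb.
move=> s; have /isOt1P [ka sa] := ha s.
have := Sb_mul (Tl_Kbar ka) (gT s) (Sb_Kbar (l := l - m) ka sa) (hN1 s) (e := l).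
rewrite addr0 subrK add0r => /(_ (lexx _) (lexx _)) h.
by apply: Sb_mono h => //; lia.
Qed.

End T1Lattices.

(** * Dimension theories *)

Section DimensionTheories.
Variable k : fieldType.
Implicit Types (U V W C A B L M Lam : K k -> Prop) (f g x y : K k) (d e a b : dimfun k).

Lemma subsp_t1lattice L M Lam : subsp L -> t1lattice L M Lam -> subsp Lam.
Proof.
move=> hL [r [g [_ [LamP _]]]]; split; [|split].
- apply/LamP; exists 0, (fun=> 0); split; first exact: subsp0.
  split=> //; rewrite KaddE -[Ksum _]/(\sum_i 0 * g i) big1 ?addr0 // => i _.
  by rewrite mul0r.
- move=> x y /LamP [u [a [hu [ha ->]]]] /LamP [v [b [hv [hb ->]]]].
  apply/LamP; exists (u + v), (fun i => a i + b i); split; first exact: subspD.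
  split=> [i p q h|]; first by rewrite KDE ha ?hb ?addr0.
  rewrite !KaddE -![Ksum _]/(\sum_i _ i * g i) addrACA; congr (_ + _).
  by rewrite -big_split; apply: eq_bigr => i _; exact: esym (mulrDl _ _ _).
move=> c x /LamP [u [a [hu [ha ->]]]].
apply/LamP; exists (c *: u), (fun i => c *: a i); split; first exact: subspZ.
split=> [i p q h|]; first by rewrite KZE ha ?mulr0.
rewrite !KaddE KscaleE -![Ksum _]/(\sum_i _ i * g i) scalerDr; congr (_ + _).
by rewrite scaler_sumr; apply: eq_bigr => i _; rewrite KscalerAl.
Qed.

(** The setting in which A/C is a subquotient of t2^m O_K / t2^l O_K and the boxes induce its
    filtration. *)
Definition slab m l C A := [/\ subsp A, subsp C, sub (Tl l) C, sub C A & sub A (Tl m)].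

Lemma slab_le m l C A : slab m l C A -> m <= l.
Proof. by move=> [_ _ h1 h2 h3]; apply: Tl_sub_le => x /h1 /h2 /h3. Qed.

(* Modulo C, a point of Gr(A/C) which does not depend on l, see base_indep. *)
Definition base l C A : K k -> Prop := plus (inter A (box l)) C.

Lemma subsp_base m l l' C A : slab m l C A -> subsp (base l' C A).
Proof.
move=> [hA hC _ _ _]; apply: subsp_plus => //; apply: subsp_inter => //; exact: subsp_Sb.
Qed.

Lemma base_sub m l l' C A : slab m l C A -> sub (base l' C A) A.
Proof. by move=> [hA hC _ CA _]; apply: plus_sub => // x []. Qed.

Lemma sub_base m l l' C A : slab m l C A -> sub C (base l' C A).
Proof. by move=> [hA hC _ CA _]; apply/sub_plusr/subsp_inter => //; apply: subsp_Sb. Qed.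

(** Truncation below t2^p changes a vector by an element of t2^p O_K, hence of C, and a truncated
    vector with no negative t1-exponents satisfies the condition for every other bound. *)
Lemma base_indep m l l' C A : slab m l C A -> sub (Tl l') C -> base l C A = base l' C A.
Proof.
move=> [hA hC lC CA _] l'C.
have half p q : sub (Tl p) C -> sub (base p C A) (base q C A).
  move=> pC; apply: plus_sub; first by apply: subsp_plus => //; apply: subsp_inter => //; apply: subsp_Sb.
    move=> x [hx bx]; have hr := @trunc_rest _ p x.
    rewrite -[x](subrK (trunc p x)) addrC; apply: plusP; last exact: pC.
    split; last exact: Sb_trunc.
    by rewrite -[trunc p x](subKr x); apply: subspB => //; apply/CA/pC.
  by apply/sub_plusr/subsp_inter => //; apply: subsp_Sb.
by apply: set_ext; apply: half.
Qed.

(** Independence of the choices in [GrQ]: each k[[t1]]-lattice is commensurable with a box, and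
    cutting by A and adding C preserve this, so every choice yields the class of [base]. *)
Lemma GrQP m l C A U : slab m l C A -> GrQ A C U <->
  [/\ subsp U, sub C U, sub U A & exists z, relindex (base l C A) U z].
Proof.
move=> sl; have [hA hC lC CA Am] := sl; have sB := subsp_base _ sl; split.
  move=> [hU [CU [UA [L [M [Lam [/lattice_is_Tl [l' ->] [/lattice_is_Tl [m' ->] [l'C [Am' [tl cU]]]]]]]]]]].
  split=> //; have m'l' : m' <= l' by apply: Tl_sub_le => x /l'C /CA /Am'.
  have sL := subsp_t1lattice (subsp_Tl k l') tl.
  have [N [h1 h2]] := t1lattice_sandwich m'l' tl.
  have [z1 rz] : exists z, relindex (Qb 0 m' l') Lam z.
    have NN : - N%:Z <= N%:Z by lia.
    apply: (sandwich_Qb NN m'l' (subsp_Qb k 0 m' l') sL _ _ h1 h2); apply: Qb_mono; lia.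
  have [z2 [_ [r2 _ _]]] := relindex_exact (subsp_Qb k _ _ _) sL hA rz.
  have [_ [z3 [_ r3 _]]] := relindex_exact (subsp_inter (subsp_Qb k _ _ _) hA) (subsp_inter sL hA) hC r2.
  have eB : plus (inter (Qb 0 m' l') A) C = base l C A.
    rewrite (base_indep sl l'C); congr (plus _ _); apply: set_ext => x.
      by move=> [[_ h] h']; split.
    by move=> [h h']; split=> //; split=> //; apply: Am'.
  rewrite eB [inter Lam A]interC in r3.
  have sAL := subsp_plus (subsp_inter hA sL) hC.
  have [z4 /relindex_sym r4] := (commensP hU sAL).1 cU.
  by exists (z3 - z4); apply: relindex_trans r3 r4.
move=> [hU CU UA [z rz]]; split=> //; split=> //; split=> //.
have ml := slab_le sl.
exists (Tl l), (Tl m), (inter (box l) (Tl m)); split; first exact: lattice_Tl.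
split; first exact: lattice_Tl.
do 2 (split=> //); split; first exact: t1lattice_box.
have -> : inter A (inter (box l) (Tl m)) = inter A (box l).
  apply: set_ext => x; first by move=> [h [h' _]]; split.
  by move=> [h h']; split=> //; split=> //; apply: Am.
by apply/(commensP hU (sB l)); exists (- z); apply: relindex_sym.
Qed.

Lemma Gr_base m l C A : slab m l C A -> GrQ A C (base l C A).
Proof.
move=> sl; apply/(GrQP _ sl); split.
- exact: (subsp_base _ sl).
- exact: sub_base sl.
- exact: base_sub sl.
- by exists 0; apply: relindex_refl; apply: (subsp_base _ sl).
Qed.

Lemma Gr_subsp C A U : GrQ A C U -> subsp U. Proof. by case. Qed.

Lemma Gr_relindex m l C A U V : slab m l C A -> GrQ A C U -> GrQ A C V ->
  exists z, relindex U V z.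
Proof.
move=> sl /(GrQP _ sl) [_ _ _ [z /relindex_sym rz]] /(GrQP _ sl) [_ _ _ [z' rz']].
by exists (- z + z'); apply: relindex_trans rz rz'; apply: (subsp_base _ sl).
Qed.

Lemma isDimP C A d : isDim A C d <->
  forall U V z, GrQ A C U -> GrQ A C V -> relindex U V z -> d V = d U + z.
Proof.
split=> [h U V z gU gV|h U V gU gV n2 n1 q2 q1].
  move=> /(relindexP _ (Gr_subsp gU) (Gr_subsp gV)) [n1 [n2 [q1 q2 ->]]].
  by rewrite (h U V gU gV n2 n1 q2 q1) addrA.
rewrite -addrA; apply: h => //.
by apply/(relindexP _ (Gr_subsp gU) (Gr_subsp gV)); exists n1, n2.
Qed.

(** The theory normalised to 0 at the base, U |-> [base|U]; the choice operator returns this index,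
    which is unique. *)
Lemma isDim_ex m l C A : slab m l C A -> exists d, isDim A C d.
Proof.
move=> sl; exists (fun U => epsilon (inhabits 0) (relindex (base l C A) U)).
apply/isDimP => U V z gU gV rz.
have [zU rU] := Gr_relindex sl (Gr_base sl) gU.
have rV := relindex_trans (Gr_subsp gU) rU rz.
have eU := epsilon_spec (inhabits 0) _ (ex_intro _ _ rU).
have eV := epsilon_spec (inhabits 0) _ (ex_intro _ _ rV).
have sB := subsp_base l sl.
rewrite (relindex_uniq sB (Gr_subsp gU) eU rU).
exact: relindex_uniq sB (Gr_subsp gV) eV rV.
Qed.

Lemma isDim_shift C A d n : isDim A C d -> isDim A C (dshift d n).
Proof.
move=> /isDimP h; apply/isDimP => U V z gU gV rz.
by rewrite /dshift (h _ _ _ gU gV rz) addrAC.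
Qed.

Lemma eqDim_isDim C A d e : eqDim A C d e -> isDim A C e -> isDim A C d.
Proof.
move=> h /isDimP he; apply/isDimP => U V z gU gV rz.
by rewrite !h // (he _ _ _ gU gV rz).
Qed.

Lemma eqDim_of_base m l C A d e : slab m l C A -> isDim A C d -> isDim A C e ->
  d (base l C A) = e (base l C A) -> eqDim A C d e.
Proof.
move=> sl /isDimP hd /isDimP he h U gU; have gB := Gr_base sl.
have [z rz] := Gr_relindex sl gB gU.
by rewrite (hd _ _ _ gB gU rz) (he _ _ _ gB gU rz) h.
Qed.

Section Tensor.
Variables (m l : int) (C2 C A : K k -> Prop).
Hypotheses (sl : slab m l C2 A) (hC : subsp C) (C2C : sub C2 C) (CA : sub C A).

Let sA : subsp A. Proof. by case: sl. Qed.
Let sC2 : subsp C2. Proof. by case: sl. Qed.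
Let lC2 : sub (Tl l) C2. Proof. by case: sl. Qed.
Let Am : sub A (Tl m). Proof. by case: sl. Qed.

Lemma slab_top : slab m l C A.
Proof. by split=> // x /lC2 /C2C. Qed.
Lemma slab_bot : slab m l C2 C.
Proof. by split=> // x /CA /Am. Qed.

(** With [base_plus], this says that the reference points are compatible with 0 -> C/C2 -> A/C2 ->
    A/C -> 0, so that [odot] evaluated at a reference point only involves values at reference
    points. *)
Lemma base_inter : inter (base l C2 A) C = base l C2 C.
Proof.
rewrite /base modular //; congr (plus _ _); apply: set_ext => x.
  by move=> [[_ h] h'].
by move=> [h h']; split=> //; split=> //; apply: CA.
Qed.

Lemma base_plus : plus (base l C2 A) C = base l C A.
Proof.
have sB : subsp (inter A (box l)) by apply: subsp_inter => //; apply: subsp_Sb.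
apply: set_ext.
  apply: plus_sub; first exact: subsp_plus.
    by apply: plusS.
  exact: sub_plusr.
by apply: plusS => //; apply: sub_plusl.
Qed.

Lemma Gr_inter U : GrQ A C2 U -> GrQ C C2 (inter U C).
Proof.
move=> /(GrQP _ sl) [hU CU UA [z rz]]; apply/(GrQP _ slab_bot).
have [z' [_ [r' _ _]]] := relindex_exact (subsp_base l sl) hU hC rz.
split; [exact: subsp_inter|exact: inter_sub|by move=> x []|].
by exists z'; rewrite -base_inter.
Qed.

Lemma Gr_plus U : GrQ A C2 U -> GrQ A C (plus U C).
Proof.
move=> /(GrQP _ sl) [hU CU UA [z rz]]; apply/(GrQP _ slab_top).
have [_ [z' [_ r' _]]] := relindex_exact (subsp_base l sl) hU hC rz.
split; [exact: subsp_plus|exact: sub_plusr|exact: plus_sub|].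
by exists z'; rewrite -base_plus.
Qed.

Lemma odot_isDim a e : isDim A C a -> isDim C C2 e -> isDim A C2 (odot C a e).
Proof.
move=> /isDimP ha /isDimP he; apply/isDimP => U V z gU gV rz.
have [z' [z'' [r' r'' ->]]] := relindex_exact (Gr_subsp gU) (Gr_subsp gV) hC rz.
rewrite /odot (he _ _ _ (Gr_inter gU) (Gr_inter gV) r').
by rewrite (ha _ _ _ (Gr_plus gU) (Gr_plus gV) r'') addrACA.
Qed.

Lemma odot_base a e : odot C a e (base l C2 A) = e (base l C2 C) + a (base l C A).
Proof. by rewrite /odot base_inter base_plus. Qed.

End Tensor.

(* The contribution of e to al and to be is the same, as it only involves C/C2. *)
Lemma graph_base m m' l C2 C A B a b al be : slab m l C2 A -> slab m' l C2 B ->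
  subsp C -> sub C2 C -> sub C A -> sub C B -> graph A B C a b C2 al be ->
  be (base l C2 B) - al (base l C2 A) = b (base l C B) - a (base l C A).
Proof.
move=> sA sB hC C2C CA CB [e [_ [ha hb]]].
rewrite ha ?hb; [|exact: Gr_base sB|exact: Gr_base sA].
by rewrite (odot_base sA) // (odot_base sB) //; ring.
Qed.

Lemma graph_isDim m l C2 C A B a b al be : slab m l C2 B -> subsp C ->
  sub C2 C -> sub C B -> isDim B C b -> graph A B C a b C2 al be -> isDim B C2 be.
Proof.
move=> sB hC C2C CB hb [e [he [_ h]]]; apply: eqDim_isDim h _.
exact: (odot_isDim sB).
Qed.

(** Every al factors as a ⊙ e' with the given a, since the theories on A/C2 form a torsor; the image
    is then b ⊙ e'. *)
Lemma graph_ex m l C2 C A B a b al : slab m l C2 A -> subsp C -> sub C2 C -> sub C A ->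
  isDim A C a -> isDim A C2 al -> exists be, graph A B C a b C2 al be.
Proof.
move=> sA hC C2C CA ha hal; have [e he] := isDim_ex (slab_bot sA hC C2C CA).
(* The constant corrects a ⊙ e to agree with al at the base, hence everywhere. *)
pose e' := dshift e (al (base l C2 A) - odot C a e (base l C2 A)).
have he' : isDim C C2 e' by apply: isDim_shift.
exists (odot C b e'), e'; split=> //; split=> //.
apply: (eqDim_of_base sA) => //; first exact: (odot_isDim sA).
by rewrite !(odot_base sA) // /e' /dshift (odot_base sA) //; ring.
Qed.

End DimensionTheories.

(** * The commutator *)

Section Commutator.
Variable k : fieldType.
Implicit Types (U V W C A B : K k -> Prop) (f g x y : K k) (d e a b : dimfun k).

Lemma slab_image m l C A f : f != 0 -> slab m l C A ->
  slab (m + nu2 f) (l + nu2 f) (image f C) (image f A).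
Proof.
move=> f0 [hA hC lC CA Am]; split; try exact: subsp_image; try exact: imageS.
  by rewrite -image_Tl //; apply: imageS.
by rewrite -image_Tl //; apply: imageS.
Qed.

Lemma image_base f l C A : f != 0 -> image f^-1 (base l (image f C) (image f A)) =
  plus (inter A (image f^-1 (box l))) C.
Proof.
by move=> f0; rewrite image_plus imageK // image_inter ?invr_neq0 // imageK.
Qed.

(** [Sb c l] restricts infinitely many rows; inside A only those from m on remain, and the finite
    box suffices. *)
Lemma inter_box_Qb c m l A : sub A (Tl m) -> inter A (Sb c l) = inter (Qb c m l) A.
Proof.
move=> Am; apply: set_ext => x; last by move=> [[_ h] h'].
by move=> [h h']; split=> //; split=> //; apply: Am.
Qed.

Lemma inter_image_box_Qb f c m l A : f != 0 -> sub A (Tl m) ->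
  inter A (image f^-1 (Sb c (l + nu2 f))) =
  inter (image f^-1 (Qb c (m + nu2 f) (l + nu2 f))) A.
Proof.
move=> f0 Am; rewrite -{1 2}(imageK A f0) -!image_inter ?invr_neq0 //.
congr (image _ _); apply: inter_box_Qb.
by rewrite -image_Tl //; apply: imageS.
Qed.

Lemma relindex_Qb_pull f n l : f != 0 -> n <= l ->
  relindex (Qb 0 n l) (image f^-1 (Qb 0 (n + nu2 f) (l + nu2 f))) (nu1 f * (l - n)).
Proof.
move=> f0 nl; have := relindex_image (invr_neq0 f0) (relindex_image_Qb f0 nl).
by rewrite imageK.
Qed.

(* The part z' lost to C does not depend on the size of the ambient slab. *)
Lemma relindex_base_pull f C l n0 : f != 0 -> subsp C -> sub (Tl l) C -> sub C (Tl n0) ->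
  exists z', forall m A, slab m l C A -> exists z,
    relindex (base l C A) (image f^-1 (base (l + nu2 f) (image f C) (image f A))) z /\
    (A = Tl m -> z = nu1 f * (l - m) - z').
Proof.
move=> f0 hC lC Cn0.
have sQ := subsp_Qb k; have sI := fun c n l => subsp_image f^-1 (sQ c n l).
have n0l : n0 <= l by apply: (@Tl_sub_le k) => x /lC /Cn0.
(* z' is fixed before A is chosen: the boxes are cut down to C in the slab starting at n0, which
   already contains C. *)
have [z' [_ [r' _ _]]] := relindex_exact (sQ _ _ _) (sI _ _ _) hC (relindex_Qb_pull f0 n0l).
exists z' => m A sl; have [hA _ _ CA Am] := sl; have ml := slab_le sl.
have rm := relindex_Qb_pull f0 ml.
have [z1 [_ [r1 _ _]]] := relindex_exact (sQ _ _ _) (sI _ _ _) hA rm.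
rewrite -inter_box_Qb // -inter_image_box_Qb // in r1.
have sb c l' : subsp (inter A (Sb c l')) by apply: subsp_inter => //; apply: subsp_Sb.
have sb' c l' : subsp (inter A (image f^-1 (Sb c l'))).
  by apply: subsp_inter => //; apply/subsp_image/subsp_Sb.
have [z2 [z3 [r2 r3 e1]]] := relindex_exact (sb _ _) (sb' _ _) hC r1.
exists z3; split; first by rewrite image_base.
(* For a full lattice A the intersection with A changes neither box, so z1 is the whole index nu1 f
   * (l - m). *)
move=> eA; have Cm : sub C (Tl m) by move=> x /CA /Am.
have e2 : z1 = nu1 f * (l - m).
  apply: relindex_uniq (sb _ _) (sb' _ _) r1 _; move: rm; congr (relindex _ _ _).
    by rewrite (inter_box_Qb _ _ Am) inter_absorb // eA => x [].
  rewrite (inter_image_box_Qb _ _ f0 Am) inter_absorb // eA => x [y [[hy _] ->]].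
  by rewrite -(imageK (Tl m) f0) image_Tl //; apply: image_in.
(* Since C lies in A and in t2^n0 O_K, the traces on C of the boxes starting at m and at n0
   coincide. *)
suff <- : z2 = z' by rewrite -e2 e1; ring.
have dropA U : inter (inter A U) C = inter C U.
  apply: set_ext => x; first by move=> [[_ h] h'].
  by move=> [h h']; split=> //; split=> //; apply: CA.
rewrite !dropA (inter_box_Qb _ _ Cn0) (inter_image_box_Qb _ _ f0 Cn0) in r2.
apply: relindex_uniq r2 r'; apply: subsp_inter => //; exact: sI.
Qed.

Lemma Gr_pull m l C A f U : f != 0 -> slab m l C A ->
  GrQ (image f A) (image f C) U -> GrQ A C (image f^-1 U).
Proof.
move=> f0 sl; have [hA hC lC CA Am] := sl.
move=> /(GrQP _ (slab_image f0 sl)) [hU CU UA [z rz]]; apply/(GrQP _ sl).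
have [|z' /(_ m A sl) [z1 [r1 _]]] := relindex_base_pull f0 hC lC (n0 := m).
  by move=> x /CA /Am.
split; first exact: subsp_image.
- by apply/image_sub => //; rewrite ?invr_neq0 ?invrK.
- by apply/image_sub; rewrite ?invr_neq0 ?invrK.
exists (z1 + z); apply: relindex_trans r1 _.
  exact/subsp_image/subsp_base/(slab_image f0 sl).
by apply: relindex_image => //; rewrite invr_neq0.
Qed.

Lemma hact_isDim m l C A f d : f != 0 -> slab m l C A -> isDim A C d ->
  isDim (image f A) (image f C) (hact f d).
Proof.
move=> f0 sl /isDimP hd; apply/isDimP => U V z gU gV rz.
rewrite /hact !preimE //; apply: hd; try exact: Gr_pull sl _.
by apply: relindex_image => //; rewrite invr_neq0.
Qed.

(** Over t2^n O_K the action of f adds nu1 f * (l - n) - z' to the value at the reference point. In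
    the difference of two lattices both l and z' cancel, and the sign of the commutator appears
    here. *)
Lemma hact_base f C l n n' d d' : f != 0 ->
  slab n l C (Tl n) -> slab n' l C (Tl n') -> sub (Tl l) (image f C) ->
  isDim (Tl n) C d -> isDim (Tl n') C d' ->
  hact f d' (base l (image f C) (image f (Tl n'))) - hact f d (base l (image f C) (image f (Tl n)))
  = d' (base l C (Tl n')) - d (base l C (Tl n)) - nu1 f * (n' - n).
Proof.
move=> f0 sl sl' lfC' /isDimP hd /isDimP hd'.
have [hA hC lC CA _] := sl.
have [z' hz'] := relindex_base_pull f0 hC lC CA.
have step m e : slab m l C (Tl m) ->
    (forall U V z, GrQ (Tl m) C U -> GrQ (Tl m) C V -> relindex U V z -> e V = e U + z) ->
    hact f e (base l (image f C) (image f (Tl m))) = e (base l C (Tl m)) + (nu1 f * (l - m) - z').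
  move=> slm he; have sI := slab_image f0 slm.
  have [z [rz /(_ erefl) ez]] := hz' _ _ slm.
  (* The pulled-back index is known for the truncation l + nu2 f; as t2^l O_K lies in f C, the
     truncation l gives the same reference point. *)
  rewrite /hact preimE // -(base_indep sI lfC') -ez; apply: he => //.
    exact: Gr_base slm.
  by apply: (Gr_pull f0 slm); apply: Gr_base sI.
by rewrite (step _ _ sl hd) (step _ _ sl' hd'); ring.
Qed.

(** C ≈ O_K supplies one t2^l O_K inside C, hence all smaller ones; this freedom lets two lifts
    share a truncation. *)
Lemma isRep_slab n' h C a b : image h (OK (k := k)) = Tl n' ->
  isRep (OK (k := k)) (image h (OK (k := k))) C a b ->
  exists l, forall l', l <= l' -> slab 0 l' C (Tl 0) /\ slab n' l' C (Tl n').
Proof.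
move=> -> [hC [CA [CB [[L [M [/lattice_is_Tl [l ->] [_ [_ [lC _]]]]]] _]]]].
exists l => l' le; split; split=> //; try exact: subsp_Tl.
  by move=> x hx; apply: lC; apply: Tl_mono hx.
by move=> x hx; apply: lC; apply: Tl_mono hx.
Qed.

Lemma isLift_ex h : h != 0 -> exists C a b, isLift h C a b.
Proof.
(* The level of the lift is t2^l O_K = O_K ∩ h O_K. *)
move=> h0; pose l := Num.max 0 (nu2 h).
have l0 : 0 <= l by rewrite le_max lexx.
have lh : nu2 h <= l by rewrite le_max lexx orbT.
have eh : image h (OK (k := k)) = Tl (nu2 h) by rewrite -[nu2 h]add0r -image_Tl.
have s1 : slab 0 l (Tl l) (Tl 0 : K k -> Prop) by split=> //; try exact: subsp_Tl; apply: Tl_mono.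
have s2 : slab (nu2 h) l (Tl l) (Tl (nu2 h) : K k -> Prop).
  by split=> //; try exact: subsp_Tl; apply: Tl_mono.
have [a ha] := isDim_ex s1; have [b hb] := isDim_ex s2.
exists (Tl l), a, b; split; first exact/eqP.
rewrite eh; split; first exact: subsp_Tl.
do 2 (split; first exact: Tl_mono).
split=> //; exists (Tl l), (Tl 0); do 2 (split; first exact: lattice_Tl).
by do !split=> //; apply: Tl_mono.
Qed.

Lemma commShift_nuK f g C1 a1 b1 C2 a2 b2 : f != 0 -> g != 0 ->
  isLift f C1 a1 b1 -> isLift g C2 a2 b2 ->
  commShift f g C1 a1 b1 C2 a2 b2 (- nuK f g).
Proof.
move=> f0 g0 [_ rep1] [_ rep2].
have ef : image f (OK (k := k)) = Tl (nu2 f) by rewrite -[nu2 f]add0r -image_Tl.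
have eg : image g (OK (k := k)) = Tl (nu2 g) by rewrite -[nu2 g]add0r -image_Tl.
have [l1 sl1] := isRep_slab ef rep1.
have [l2 sl2] := isRep_slab eg rep2.
(* The four bounds put t2^N O_K inside C1, C2, f C2 and g C1, so that it is a common lower level for
   all four homomorphisms. *)
have [N [N1 N2 N3 N4]] : exists N, [/\ l1 <= N, l2 <= N, l2 + nu2 f <= N & l1 + nu2 g <= N].
  exists (Num.max (Num.max l1 l2) (Num.max (l2 + nu2 f) (l1 + nu2 g))).
  by rewrite !le_max !lexx ?orbT.
case: rep1 => hC1 [C1O [C1f [_ [da1 db1]]]].
case: rep2 => hC2 [C2O [C2g [_ [da2 db2]]]].
have [s1 s1'] := sl1 _ N1; have [s2 s2'] := sl2 _ N2.
have NC1 : sub (Tl N) C1 by case: s1.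
have NC2 : sub (Tl N) C2 by case: s2.
have NfC2 : sub (Tl N) (image f C2).
  have [t _] := sl2 _ (lexx l2); have [_ _ h _ _] := slab_image f0 t.
  by move=> x hx; apply: h; apply: Tl_mono hx.
have NgC1 : sub (Tl N) (image g C1).
  have [t _] := sl1 _ (lexx l1); have [_ _ h _ _] := slab_image g0 t.
  by move=> x hx; apply: h; apply: Tl_mono hx.
have N0 : 0 <= N := slab_le s1.
have slT m l C : slab m l C (Tl m) -> sub (Tl N) C -> slab m N (Tl N) (Tl m : K k -> Prop).
  move=> [_ _ _ h _] h'; split=> //; try exact: subsp_Tl.
  by move=> x /h' /h.
have sO := slT _ _ _ s1 NC1; have sf := slT _ _ _ s1' NC1; have sg := slT _ _ _ s2' NC2.
have ff : image f (Tl 0) = Tl (nu2 f) := ef.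
have gg : image g (Tl 0) = Tl (nu2 g) := eg.
have sfg : slab (nu2 g + nu2 f) N (Tl N) (image f (Tl (nu2 g))).
  rewrite image_Tl //; apply: (slT _ _ (image f C2)) => //.
  by have := slab_image f0 s2'; rewrite -image_Tl //; apply.
have egf : image g (Tl (nu2 f)) = image f (Tl (nu2 g)) by rewrite -ff -gg image_swap.
rewrite ef in C1f db1; rewrite eg in C2g db2.
have fC2f : sub (image f C2) (Tl (nu2 f)) by rewrite -ff; apply: imageS.
have fC2fg : sub (image f C2) (image f (Tl (nu2 g))) by apply: imageS.
have gC1g : sub (image g C1) (Tl (nu2 g)) by rewrite -gg; apply: imageS.
have gC1fg : sub (image g C1) (image f (Tl (nu2 g))) by rewrite -egf; apply: imageS.
have hfC2 := subsp_image f hC2; have hgC1 := subsp_image g hC1.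
have dfa2 := hact_isDim f0 s2 da2; rewrite ff in dfa2.
have dfb2 := hact_isDim f0 s2' db2.
have dga1 := hact_isDim g0 s1 da1; rewrite gg in dga1.
have dgb1 := hact_isDim g0 s1' db1; rewrite egf in dgb1.
have H2 := hact_base f0 s2 s2' NfC2 da2 db2; rewrite ff in H2.
have H4 := hact_base g0 s1 s1' NgC1 da1 db1; rewrite gg egf in H4.
rewrite /commShift eg ef egf; exists (Tl N).
split; first exact: subsp_Tl.
split; first exact: inter_sub.
do 2 (split=> //); split.
  exists (Tl N), (Tl 0); do 2 (split; first exact: lattice_Tl).
  by do !split=> //; apply: Tl_mono.
split; first exact: isDim_ex sO.
move=> al dal; split.
  have [be G1] := graph_ex (Tl (nu2 f)) b1 sO hC1 NC1 C1O da1 dal.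
  have dbe := graph_isDim sf hC1 NC1 C1f db1 G1.
  have [ga G2] := graph_ex (image f (Tl (nu2 g))) (hact f b2) sf hfC2 NfC2 fC2f dfa2 dbe.
  by exists be, ga.
split.
  have [be G3] := graph_ex (Tl (nu2 g)) b2 sO hC2 NC2 C2O da2 dal.
  have dbe := graph_isDim sg hC2 NC2 C2g db2 G3.
  have [ga G4] := graph_ex (image f (Tl (nu2 g))) (hact g b1) sg hgC1 NgC1 gC1g dga1 dbe.
  by exists be, ga.
move=> be ga be' ga' G1 G2 G3 G4.
have dga := graph_isDim sfg hfC2 NfC2 fC2fg dfb2 G2.
have dga' := graph_isDim sfg hgC1 NgC1 gC1fg dgb1 G4.
apply: (eqDim_of_base sfg dga); first exact: isDim_shift.
(* Each homomorphism adds the difference of its two theories at the reference points. Along both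
   paths from al the contributions b1 - a1 and b2 - a2 agree; only the corrections -nu1 f * nu2 g
   and -nu1 g * nu2 f from [H2] and [H4] differ. *)
have := graph_base sO sf hC1 NC1 C1O C1f G1.
have := graph_base sf sfg hfC2 NfC2 fC2f fC2fg G2.
have := graph_base sO sg hC2 NC2 C2O C2g G3.
have := graph_base sg sfg hgC1 NgC1 gC1g gC1fg G4.
rewrite H2 H4 /dshift /nuK; change (OK (k := k)) with (Tl 0 : K k -> Prop).
lia.
Qed.

End Commutator.

(* For all f, g in K^* (K = k((t1))((t2)), L = O_K):  psi_V(f,g) = - nu_K(f,g). *)
Theorem theorem1 (k : fieldType) (f g : K k) :
  f <> K0 k -> g <> K0 k -> psiV f g (- nuK f g).
Proof.
move=> /eqP f0 /eqP g0; split; last by move=> *; apply: commShift_nuK.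
have [C1 [a1 [b1 lf]]] := isLift_ex f0; have [C2 [a2 [b2 lg]]] := isLift_ex g0.
by exists C1, a1, b1, C2, a2, b2.
Qed.
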